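(* Fix $k\in\mathbb{N}$. Let $m,\Delta\ge 1$ and let $H$ be a random $(m,\Delta,k)$-multihypergraph of linear type. Then $\mathbb{E}[\mathrm{surp}(H)]=\Omega(m/\sqrt{\Delta})$.
   Context: A random multihypergraph $H=(V,R)$ on a vertex set $V$ is a random $(m,\Delta,k)$-multihypergraph of linear type if: (i) there is a multiset $X$ of subsets of $V$ of size at most $k$ (potential hyperedges) with $|X|=O(m)$, a set $\mathcal{S}$, independent random variables $(Z_i)_{i\in\mathcal S}$, and for every $e\in X$ a set $S_e\subseteq\mathcal S$ with $|S_e|\le k$ such that the event $e\in R$ (where $R\subseteq X$ is the random edge multiset) is a function of $\{Z_i:i\in S_e\}$; (ii) for all $e,f\in X$, $\mathbb{P}(e\in R,f\in R)\ge \mathbb P(e\in R)\mathbb P(f\in R)$; (iii) there is $Y\subseteq X$ with $|Y|=\Omega(m)$ such that every $e\in Y$ has $|e|\ge 2$ and $\Omega(1)=\mathbb P(e\in R)=1-\Omega(1)$; (iv) every vertex $u\in V$ lies in at most $\Delta$ elements of $X$; (v) there is $D=O(1)$ such that any two distinct vertices lie together in at most $D$ elements of $X$, and for every $u\in V$ and $i\in\mathcal S$ at most $D$ elements $e\in X$ satisfy $u\in e$ and $i\in S_e$. The implicit constants in (i)–(v) are fixed, and the implicit constant in the conclusion depends only on $k$ and these constants. For a multihypergraph, $\mathrm{surp}$ denotes the maximum over $2$-cuts (partitions of $V$ into two parts) of the number of edges meeting both parts minus the expected such number for a uniformly random $2$-cut. *)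

(* Defs.v *)
From mathcomp Require Import all_boot all_order all_algebra finmap.
From mathcomp Require Import all_classical all_reals all_analysis.

Set Implicit Arguments.
Unset Strict Implicit.
Unset Printing Implicit Defensive.
Import Order.TTheory GRing.Theory Num.Theory.
Local Open Scope classical_set_scope.
Local Open Scope ring_scope.

(* A finite multiset of subsets of V is a family X : E -> {set V} over a finite
   index type E, so repeated subsets have distinct indices. A sub-multiset is a
   set of indices, and cardinalities of sets of indices count multiplicities. *)

Section Surplus.
Variables (V E : finType) (X : E -> {set V}).

(* The 2-cut with parts B and ~: B; either part may be empty. *)
Definition is_cut (B : {set V}) (e : E) : bool :=
  (X e :&: B != finset.set0) && (X e :\: B != finset.set0).

Definition cut_size (H : {set E}) (B : {set V}) : nat :=
  #|[pred e in H | is_cut B e]|.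

(* A uniformly random B : {set V} puts each vertex independently in either part
   with probability 1/2; each unordered partition arises from B and ~: B. *)
Definition mean_cut (R : realType) (H : {set E}) : R :=
  (\sum_(B : {set V}) (cut_size H B)%:R) / #|{set V}|%:R.

Definition surp (R : realType) (H : {set E}) : R :=
  (\max_(B : {set V}) cut_size H B)%:R - mean_cut R H.

End Surplus.

Section Families.
Context {d : measure_display} {T : measurableType d} {R : realType}.
Variables (P : probability T R).
Variables (I : choiceType) (dU : I -> measure_display).
Variables (U : forall i, measurableType (dU i)).
Variables (Z : forall i, {mfun T >-> U i}).

(* The product sigma-algebra on the product of the U i, for i in J. *)
Definition product_sigma_algebra (J : {fset I}) :
    set (set (forall i : J, U (val i))) :=
  <<s [set C | exists (i : J) (B : set (U (val i))),
         measurable B /\ C = [set z | B (z i)]] >>.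

(* The event A is determined by a measurable condition on (Z i)_(i in J). *)
Definition is_function_of (J : {fset I}) (A : set T) : Prop :=
  exists2 F : set (forall i : J, U (val i)),
    product_sigma_algebra F & A = [set w | F (fun i => Z (val i) w)].

Definition mutually_independent : Prop :=
  forall (J : {fset I}) (B : forall i, set (U i)),
    (forall i, measurable (B i)) ->
    P (\bigcap_(i in [set` J]) (Z i @^-1` B i)) =
      (\prod_(i <- J) P (Z i @^-1` B i))%E.

End Families.

Section LinearType.
Context {d : measure_display} {T : measurableType d} {R : realType}.
Variables (P : probability T R) (V E : finType).
Variables (X : E -> {set V}) (H : T -> {set E}).

Definition edge_event (e : E) : set T := [set w | e \in H w].

(* The parameters a, b, p, q, D are the implicit constants:
   |X| <= a m, |Y| >= b m, p <= P(e in H) <= 1 - q for e in Y, and D bounds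
   the codegrees. *)
Record linear_type_wrt (k D : nat) (a b p q m Delta : R)
    (I : choiceType) (dU : I -> measure_display)
    (U : forall i, measurableType (dU i)) (Z : forall i, {mfun T >-> U i})
    (S : E -> {fset I}) : Prop := LinearTypeWrt {
  lt_edge_size : forall e, (#|X e| <= k)%N ;
  lt_card : #|E|%:R <= a * m ;
  lt_indep : mutually_independent P Z ;
  lt_supp_size : forall e, (#|` S e| <= k)%N ;
  lt_event : forall e, is_function_of Z (S e) (edge_event e) ;
  lt_correl : forall e f,
    (P (edge_event e) * P (edge_event f) <= P (edge_event e `&` edge_event f))%E ;
  lt_good : exists Y : {set E},
    b * m <= #|Y|%:R /\
    forall e, e \in Y ->
      [/\ (2 <= #|X e|)%N, (p%:E <= P (edge_event e))%E
        & (P (edge_event e) <= (1 - q)%:E)%E] ;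
  lt_deg : forall u, #|[pred e | u \in X e]|%:R <= Delta ;
  lt_codeg : forall u v, u != v ->
    (#|[pred e | (u \in X e) && (v \in X e)]| <= D)%N ;
  lt_codeg_supp : forall u i,
    (#|[pred e | (u \in X e) && (i \in S e)]| <= D)%N
}.

Definition linear_type (k D : nat) (a b p q m Delta : R) : Prop :=
  exists (I : choiceType) (dU : I -> measure_display)
    (U : forall i, measurableType (dU i)) (Z : forall i, {mfun T >-> U i})
    (S : E -> {fset I}),
    linear_type_wrt k D a b p q m Delta Z S.

End LinearType.

(* Main.v *)
Require Import Defs.
From mathcomp Require Import all_boot all_order all_algebra finmap.
From mathcomp Require Import all_classical all_reals all_analysis.
From mathcomp Require Import ring lra.
Import Order.TTheory GRing.Theory Num.Theory.
Set Implicit Arguments.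
Unset Strict Implicit.
Unset Printing Implicit Defensive.
Local Open Scope ring_scope.

(* Write w_e for the centred indicator of the event that e is in the random
   edge set K. Orient each good edge e of Y from src e to dst e, draw
   independent uniform signs y_u, and let
     F_v = eta * \sum_(e in Y, dst e = v) w_e y_(src e),
   with eta = eps / sqrt Delta. The point x_v = y_v / 2 - tau * sin F_v of the
   cube [-1, 1]^V bounds the surplus from below, because the surplus dominates
   every value on the cube of the multilinear extension
   - \sum_(e in K) 2^(1 - |e|) \sum_(S subset of e, |S| even, S nonempty) x_S.
   Expand x_S into products of sines (J, a subset of S) and signs (S minus J).
   - The terms |S| = 2, |J| = 1 give a gain of order tau * eta * |Y|: positive
     correlation prevents cancellation between parallel edges.
   - If a sign is left over, averaging over y exposes a factor eta, so the term
     is O(tau^2 eta) when |J| >= 2, and O(tau eta^2) when |J| = 1, |S| > 2.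
   - If S = J, the average over y is exactly a difference of two products of
     cosines. Telescoped over the vertices t, it is a sum of terms of order
     eta^2, each linear up to O(eta^2) in the centred edges from t to a fixed v
     in S. Replacing K by its part independent of these edges changes the
     cofactor by O(eta) only, so each term is O(eta^3), except at the vertices t
     where two relevant edges share a random variable; by the codegree condition
     there are O(|E|) of those in total.
   With eps and then tau small constants, the gain dominates. *)

(** * Trigonometric estimates and averages over random signs *)

Section Trigonometry.
Variable R : realType.
Implicit Types x y : R.

(** The bound on [df] is asked only between [x] and [y]. For [y = 0] this allows an [M] of size [x],
    which is how the quadratic estimates for [cos x - 1] and [sin x - x] arise. *)
Lemma normB_le_deriv (f df : R -> R) x y (M : R) :
  (forall z, is_derive z (1 : R) f (df z)) ->
  (forall z, Num.min x y <= z <= Num.max x y -> `|df z| <= M) ->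
  `|f x - f y| <= M * `|x - y|.
Proof.
move=> fd dM; wlog xy : x y dM / y < x.
  move=> wlg; have [xy|xy|->] := ltgtP y x; first exact: wlg.
    by rewrite distrC (distrC x y); apply: wlg => // z; rewrite minC maxC; exact: dM.
  by rewrite !subrr normr0 mulr0.
have [c cyx ->] := @MVT _ f df y x xy (fun z _ => fd z)
  (derivable_within_continuous (fun z _ => @ex_derive _ _ _ _ _ _ _ (fd z))).
rewrite normrM ler_wpM2r// dM// (min_r (ltW xy)) (max_l (ltW xy)).
by move: cyx; rewrite in_itv /= => /andP[/ltW -> /ltW ->].
Qed.

Lemma cos_lipschitz x y : `|cos x - cos y| <= `|x - y|.
Proof.
rewrite -[leRHS]mul1r; apply: (@normB_le_deriv cos (fun z => - sin z)) => z.
by rewrite normrN sin_max.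
Qed.

Lemma sin_lipschitz x y : `|sin x - sin y| <= `|x - y|.
Proof.
rewrite -[leRHS]mul1r; apply: (@normB_le_deriv sin cos) => z.
by rewrite cos_max.
Qed.

Lemma normr_sin_le x : `|sin x| <= `|x|.
Proof. by have := sin_lipschitz x 0; rewrite sin0 !subr0. Qed.

Lemma ler_norm_between x z : Num.min x 0 <= z <= Num.max x 0 -> `|z| <= `|x|.
Proof.
case: (leP x 0) => [x0|/ltW x0] /andP[z1 z2].
  by rewrite !ler0_norm ?lerN2.
by rewrite !ger0_norm.
Qed.

Lemma cos_sub1_le x : `|cos x - 1| <= x ^+ 2.
Proof.
rewrite -cos0 -real_normK ?num_real// expr2 -{3}[x]subr0.
apply: (@normB_le_deriv cos (fun z => - sin z)) => z.
by move=> /ler_norm_between; rewrite normrN; exact: le_trans (normr_sin_le z).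
Qed.

Lemma sin_sub_le x : `|sin x - x| <= x ^+ 2.
Proof.
have dsin z : is_derive z (1 : R) (fun z => sin z - z) (cos z - 1).
  exact: is_deriveB.
have := @normB_le_deriv _ _ x 0 `|x| dsin.
rewrite sin0 !subr0 -expr2 real_normK ?num_real//; apply => z.
move=> /ler_norm_between; apply: le_trans.
by rewrite -cos0 -[leRHS]normr_id -{2}[z]subr0 normr_id cos_lipschitz.
Qed.

(** The product-to-sum formula, with each cosine written as a sine shifted by a quarter period, so
    that it can be iterated on long products of sines. *)
Lemma mul_sin_sin x y :
  sin x * sin y = (sin (x - y + pi / 2) - sin (x + y + pi / 2)) / 2.
Proof. by rewrite !sinDpihalf cosB cosD; field. Qed.

End Trigonometry.

Section Products.
Variable R : realType.

Lemma prod_norm_le1 (I : Type) (r : seq I) (P : pred I) (F : I -> R) :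
  (forall i, P i -> `|F i| <= 1) -> `|\prod_(i <- r | P i) F i| <= 1.
Proof.
by move=> F1; rewrite normr_prod; apply: prodr_ile1 => i Pi; rewrite normr_ge0 F1.
Qed.

Lemma prodB_norm_le (I : Type) (r : seq I) (P : pred I) (F G : I -> R) :
  (forall i, P i -> `|F i| <= 1) -> (forall i, P i -> `|G i| <= 1) ->
  `|\prod_(i <- r | P i) F i - \prod_(i <- r | P i) G i|
    <= \sum_(i <- r | P i) `|F i - G i|.
Proof.
move=> F1 G1; elim: r => [|i r IHr]; first by rewrite !big_nil subrr normr0.
rewrite !big_cons; case: ifP => // Pi.
set A := \prod_(j <- r | P j) F j; set B := \prod_(j <- r | P j) G j.
have -> : F i * A - G i * B = (F i - G i) * A + G i * (A - B) by ring.
rewrite (le_trans (ler_normD _ _))// !normrM lerD//.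
  by rewrite ler_piMr// prod_norm_le1.
by rewrite (le_trans _ IHr)// ler_piMl// G1.
Qed.

(** The factors are switched one index at a time; [h i j] records which family supplies factor [j]
    while [i] is switched. It depends on the order of [r] alone, so a single [h] serves all [F] and
    [G], in particular all edge sets. *)
Lemma prodB_telescope (I : eqType) (r : seq I) : uniq r ->
  exists h : I -> I -> bool, forall F G : I -> R,
    \prod_(i <- r) F i - \prod_(i <- r) G i =
    \sum_(i <- r) (F i - G i) *
      \prod_(j <- r | j != i) (if h i j then F j else G j).
Proof.
elim: r => [_|x r IHr /= /andP[xr ur]].
  by exists (fun _ _ => true) => F G; rewrite !big_nil subrr.
have [h hE] := IHr ur.
exists (fun i j => if i == x then true else if j == x then false else h i j).
move=> F G; rewrite !big_cons eqxx /=.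
have -> a b c d : a * b - c * d = (a - c) * b + c * (b - d) :> R by ring.
congr (_ * _ + _).
  rewrite big_seq [RHS]big_seq_cond; apply: eq_bigl => j.
  by case: (boolP (j \in r)) => //= jr; rewrite (memPn xr _ jr).
rewrite hE big_distrr /= big_seq [RHS]big_seq; apply: eq_bigr => i ir.
rewrite big_cons eq_sym (memPn xr _ ir) eqxx !(negbTE (memPn xr _ ir)).
rewrite mulrCA; congr (_ * (_ * _)).
rewrite big_seq_cond [RHS]big_seq_cond; apply: eq_bigr => j /andP[jr _].
by rewrite (negbTE (memPn xr _ jr)).
Qed.

Lemma prod_setD_expand (I : finType) (A : {set I}) (F G : I -> R) :
  \prod_(i in A) (F i + G i) =
  \sum_(J : {set I} | J \subset A) (\prod_(i in J) F i) * \prod_(i in A :\: J) G i.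
Proof.
rewrite big_mkcond /=.
(* Outside [A] the first summand is 0 and the second is 1, so every [J] not contained in [A] drops
   out of the full distributive expansion. *)
rewrite (eq_bigr (fun i => (if i \in A then F i else 0) +
                          (if i \in A then G i else 1))); last first.
  by move=> i _; case: ifP => // _; rewrite add0r.
rewrite bigA_distr [RHS]big_mkcond; apply: eq_bigr => J _; case: ifP => JA.
  rewrite [X in X * _]big_mkcond [X in _ * X]big_mkcond -big_split /=.
  apply: eq_bigr => i _; rewrite inE; case: ifP => iJ /=.
    by rewrite (fintype.subsetP JA _ iJ) mulr1.
  by case: ifP; rewrite mul1r.
have /fintype.subsetPn[i iJ iA] := negbT JA.
by rewrite (bigD1 i)//= iJ (negbTE iA) mul0r.
Qed.

End Products.

Section RandomSigns.
Variables (R : realType) (V : finType).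
Implicit Types (B U : {set V}) (c : V -> R).

(** A uniformly random subset [B] plays the role of a family of independent uniform signs. *)
Definition sgn B (v : V) : R := (-1) ^+ (v \in B).

Definition flip (x : V) B : {set V} := if x \in B then B :\ x else x |: B.

Lemma flipK x : involutive (flip x).
Proof.
move=> B; rewrite /flip; case: (boolP (x \in B)) => xB; last first.
  by rewrite finset.setU11 finset.setU1K.
by rewrite finset.setD11 finset.setD1K.
Qed.

Lemma sgn_flip x B v : sgn (flip x B) v = if v == x then - sgn B v else sgn B v.
Proof.
rewrite /sgn /flip; case: (eqVneq v x) => [->|vx].
  by case: ifP; rewrite !inE eqxx//= => _; rewrite ?expr0 ?expr1 ?opprK.
by case: ifP; rewrite !inE (negbTE vx).
Qed.

Lemma normr_sgn B v : `|sgn B v| = 1.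
Proof. by rewrite /sgn normrX normrN1 expr1n. Qed.

Definition avg (h : {set V} -> R) : R := (\sum_B h B) / #|{set V}|%:R.

Lemma card_setT_neq0 : #|{set V}|%:R != 0 :> R.
Proof. by rewrite pnatr_eq0 -lt0n; apply/card_gt0P; exists (finset.set0). Qed.

Lemma avg_cst (x : R) : avg (fun=> x) = x.
Proof. by rewrite /avg sumr_const -[X in X / _]mulr_natr mulfK ?card_setT_neq0. Qed.

Lemma avgZl (x : R) h : avg (fun B => x * h B) = x * avg h.
Proof. by rewrite /avg -mulr_sumr mulrA. Qed.

Lemma avgN h : avg (fun B => - h B) = - avg h.
Proof. by rewrite /avg sumrN mulNr. Qed.

Lemma avg_sum (I : Type) (r : seq I) (P : pred I) (h : I -> {set V} -> R) :
  avg (fun B => \sum_(i <- r | P i) h i B) = \sum_(i <- r | P i) avg (h i).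
Proof. by rewrite /avg exchange_big mulr_suml. Qed.

(** Averages over the sign at [x] with all other signs fixed: [flip x] permutes the sets [B]. *)
Lemma avg_flip x h : avg h = avg (fun B => (h B + h (flip x B)) / 2).
Proof.
rewrite /avg; congr (_ / _); rewrite -mulr_suml big_split /=.
rewrite [X in _ + X](reindex_inj (can_inj (flipK x))) /=.
by under [X in _ + X]eq_bigr do rewrite flipK; field.
Qed.

(** The signs are integrated out one at a time. With [s] the sign at [x], the average of
    [sin (c s + A)] is [cos c * sin A], and that of [s * sin (c s + A)] is [sin c * cos A], that is,
    a sine factor and a phase shift by [pi / 2]. *)
Let avg_sin_seq U c (theta : R) (r : seq V) : uniq r ->
  avg (fun B => (\prod_(u <- r | u \in U) sgn B u) *
                sin (\sum_(u <- r) c u * sgn B u + theta)) =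
  sin (theta + pi / 2 * (count [in U] r)%:R) *
  \prod_(u <- r) (if u \in U then sin (c u) else cos (c u)).
Proof.
elim: r theta => [theta _|x r IHr theta /= /andP[xr ur]].
  rewrite !big_nil mulr0 addr0 mulr1 -[RHS]avg_cst.
  by congr avg; apply/funext => B; rewrite !big_nil mul1r add0r.
rewrite (avg_flip x) big_cons.
pose P B := \prod_(u <- r | u \in U) sgn B u.
pose A B := \sum_(u <- r) c u * sgn B u + theta.
have Pf B : P (flip x B) = P B.
  rewrite /P big_seq_cond [RHS]big_seq_cond; apply: eq_bigr => u /andP[ur' _].
  by rewrite sgn_flip (negbTE (memPn xr _ ur')).
have Af B : A (flip x B) = A B.
  rewrite /A; congr (_ + _); rewrite big_seq [RHS]big_seq.
  by apply: eq_bigr => u ur'; rewrite sgn_flip (negbTE (memPn xr _ ur')).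
have E1 B : \sum_(u <- x :: r) c u * sgn B u + theta = c x * sgn B x + A B.
  by rewrite big_cons addrA.
have E2 B : \sum_(u <- r) c u * sgn B u + (theta + pi / 2) = A B + pi / 2.
  by rewrite addrA.
case: ifP => xU.
- rewrite mulrCA -[theta + _](_ : theta + pi / 2 + pi / 2 * (count [in U] r)%:R = _);
    last by rewrite natrD mulrDr mulr1 addrA.
  rewrite -IHr// /avg mulrA; congr (_ / _).
  rewrite mulr_sumr; apply: eq_bigr => B _.
  rewrite !E1 !big_cons xU -!/(P _) Pf Af sgn_flip eqxx E2.
  rewrite sinDpihalf !sinD.
  rewrite mulrN sinN cosN /sgn; case: (x \in B).
    by rewrite expr1 !mulrN1 sinN cosN; field.
  by rewrite expr0 !mulr1; field.
- rewrite mulrCA -IHr// /avg mulrA; congr (_ / _).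
  rewrite mulr_sumr; apply: eq_bigr => B _.
  rewrite !E1 !big_cons xU -!/(P _) Pf Af sgn_flip eqxx.
  rewrite -/(A B) !sinD.
  rewrite mulrN sinN cosN /sgn; case: (x \in B).
    by rewrite expr1 !mulrN1 sinN cosN; field.
  by rewrite expr0 !mulr1; field.
Qed.

Lemma avg_sgn_sin U c (theta : R) :
  avg (fun B => (\prod_(u in U) sgn B u) * sin (\sum_u c u * sgn B u + theta)) =
  sin (theta + pi / 2 * #|U|%:R) *
  \prod_u (if u \in U then sin (c u) else cos (c u)).
Proof.
have := avg_sin_seq U c theta (index_enum_uniq V).
by rewrite -sum1_count sum1_card.
Qed.

End RandomSigns.

(** * Products of sines; rounding a point of the cube to a cut *)

Section SineProducts.
Variable R : realType.

(** Induction on [s]: the product-to-sum formula absorbs one sine at a time into [A]. Only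
    compatibility of [L] with half-differences is asked, so the same lemma applies to averages over
    signs and over edge sets. *)
Let sine_product_shift_le (Omega I : Type) (L : (Omega -> R) -> R) (M : R)
    (F : I -> Omega -> R) (s : seq I) (A : Omega -> R) :
  (forall f g, L (fun w => (f w - g w) / 2) = (L f - L g) / 2) ->
  (forall (c : seq bool) (theta : R), `|L (fun w => sin (A w +
     \sum_(p <- zip c s) (-1) ^+ p.1 * F p.2 w + theta))| <= M) ->
  `|L (fun w => sin (A w) * \prod_(i <- s) sin (F i w))| <= M.
Proof.
move=> Llin; elim: s A => [|x s IHs] A LM.
  apply: le_trans (LM [::] 0); rewrite le_eqVlt; apply/orP; left; apply/eqP.
  congr (`|L _|); apply/funext => w; rewrite !big_nil mulr1 !addr0 //.
have H (b : bool) : `|L (fun w => sin (A w + (-1) ^+ b * F x w + pi / 2) *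
    \prod_(i <- s) sin (F i w))| <= M.
  apply: IHs => c theta; have := LM (b :: c) (theta + pi / 2).
  congr (`|L _| <= M); apply/funext => w; rewrite /= big_cons /=.
  by congr sin; ring.
have -> : (fun w => sin (A w) * \prod_(i <- x :: s) sin (F i w)) = (fun w =>
    (sin (A w + (-1) ^+ true * F x w + pi / 2) * \prod_(i <- s) sin (F i w) -
     sin (A w + (-1) ^+ false * F x w + pi / 2) * \prod_(i <- s) sin (F i w)) / 2).
  apply/funext => w; rewrite big_cons mulrA mul_sin_sin expr1 expr0 mulN1r mul1r.
  by field.
rewrite Llin normrM (ger0_norm (_ : 0 <= 2^-1)) ?invr_ge0//.
rewrite ler_pdivrMr// mulrDr mulr1 (le_trans (ler_normB _ _))// lerD ?H//.
Qed.

(* Products of sines are averages of sines of signed sums, up to phase shifts. *)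
Lemma sine_product_le (Omega : Type) (I : finType) (L : (Omega -> R) -> R) (M : R)
    (F : I -> Omega -> R) (A : {set I}) :
  (forall f g, L (fun w => (f w - g w) / 2) = (L f - L g) / 2) ->
  (forall (c : I -> R) (theta : R), (forall i, `|c i| <= 1) ->
     `|L (fun w => sin (\sum_(i in A) c i * F i w + theta))| <= M) ->
  `|L (fun w => \prod_(i in A) sin (F i w))| <= M.
Proof.
move=> Llin LM.
have -> : (fun w => \prod_(i in A) sin (F i w)) =
    (fun w => sin (pi / 2) * \prod_(i <- enum A) sin (F i w)).
  by apply/funext => w; rewrite sin_pihalf mul1r big_enum.
apply: sine_product_shift_le => // c theta.
(* The sign of [i] is read off at its position in [enum A]; it is 0 where [zip] has truncated the
   sum. *)
pose c' (i : I) : R := if (index i (enum A) < size c)%N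
  then (-1) ^+ nth false c (index i (enum A)) else 0.
have c'1 i : `|c' i| <= 1.
  by rewrite /c'; case: ifP => _; rewrite ?normr0// normrX normrN1 expr1n.
have := LM c' (theta + pi / 2) c'1; congr (`|L _| <= M).
apply/funext => w.
suff -> : \sum_(i in A) c' i * F i w =
    \sum_(p <- zip c (enum A)) (-1) ^+ p.1 * F p.2 w by congr sin; ring.
rewrite -[LHS]big_enum /c' /=.
elim: (enum A) (enum_uniq (mem A)) c {c' c'1} => [|x s IHs] /= us c.
  by case: c => [|? ?]; rewrite !big_nil.
case/andP: us => xs us; rewrite big_cons eqxx; case: c => [|b c] /=.
  by rewrite big_nil mul0r add0r big1// => i _; rewrite mul0r.
rewrite big_cons /= -IHs//; congr (_ + _).
rewrite big_seq [RHS]big_seq; apply: eq_bigr => i js.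
by rewrite (negbTE (_ : x != i)) //; apply: contraNneq xs => ->.
Qed.

End SineProducts.

Section Rounding.
Variables (R : realType) (V E : finType) (X : E -> {set V}).
Implicit Types (x : V -> R) (A B : {set V}) (K : {set E}).

(** The probability of the part [B] when each vertex enters it independently with probability
    [(1 + x v) / 2]. *)
Definition rounding x B : R :=
  \prod_v (if v \in B then (1 + x v) / 2 else (1 - x v) / 2).

Lemma rounding_ge0 x B : (forall v, `|x v| <= 1) -> 0 <= rounding x B.
Proof.
move=> x1; apply: prodr_ge0 => v _.
by have := x1 v; rewrite ler_norml; case: ifP => _; lra.
Qed.

Let sum_rounding_on x (a b : V -> R) :
  \sum_B rounding x B * (\prod_v (if v \in B then a v else b v)) =
  \prod_v ((1 + x v) / 2 * a v + (1 - x v) / 2 * b v).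
Proof.
rewrite bigA_distr; apply: eq_bigr => B _; rewrite -big_split /=.
by apply: eq_bigr => v _; case: ifP.
Qed.

Lemma sum_rounding x : \sum_B rounding x B = 1.
Proof.
rewrite -[RHS](_ : \prod_v ((1 + x v) / 2 * 1 + (1 - x v) / 2 * 1) = 1).
  rewrite -(sum_rounding_on x (fun=> 1) (fun=> 1)); apply: eq_bigr => B _.
  by rewrite big1 ?mulr1// => v _; rewrite if_same.
by rewrite big1// => v _; field.
Qed.

Lemma sum_rounding_subset x (A : {set V}) :
  \sum_B rounding x B * (A \subset B)%:R = \prod_(v in A) ((1 + x v) / 2).
Proof.
transitivity (\sum_B rounding x B *
    \prod_v (if v \in B then 1 else (v \notin A)%:R)).
  apply: eq_bigr => B _; congr (_ * _); case: (boolP (A \subset B)) => AB.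
    rewrite big1// => v _; case: ifP => // vB.
    by rewrite (_ : v \notin A)//; apply: contraFN vB => /(fintype.subsetP AB).
  have /fintype.subsetPn[v vA vB] := AB.
  by rewrite (bigD1 v)//= (negbTE vB) vA mul0r.
rewrite sum_rounding_on [RHS]big_mkcond; apply: eq_bigr => v _.
by case: (v \in A) => /=; field.
Qed.

Lemma sum_rounding_disjoint x (A : {set V}) :
  \sum_B rounding x B * (A :&: B == finset.set0)%:R =
  \prod_(v in A) ((1 - x v) / 2).
Proof.
transitivity (\sum_B rounding x B *
    \prod_v (if v \in B then (v \notin A)%:R else 1)).
  apply: eq_bigr => B _; congr (_ * _); case: eqP => AB.
    rewrite big1// => v _; case: ifP => // vB.
    rewrite (_ : v \notin A)//; apply/negP => vA.
    by move/setP/(_ v): AB; rewrite !inE vA vB.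
  have /finset.set0Pn[v] : A :&: B != finset.set0 by apply/eqP.
  by rewrite !inE => /andP[vA vB]; rewrite (bigD1 v)//= vB vA mul0r.
rewrite sum_rounding_on [RHS]big_mkcond; apply: eq_bigr => v _.
by case: (v \in A) => /=; field.
Qed.

(** An edge is uncut when it lies inside [B] or misses [B]; for a nonempty edge these two events
    exclude each other. *)
Lemma sum_rounding_is_cut x e : X e != finset.set0 ->
  \sum_B rounding x B * (is_cut X B e)%:R =
  1 - \prod_(v in X e) ((1 + x v) / 2) - \prod_(v in X e) ((1 - x v) / 2).
Proof.
move=> /finset.set0Pn[v ve].
rewrite -sum_rounding_subset -sum_rounding_disjoint.
rewrite -[X in _ = X - _ - _](sum_rounding x).
rewrite -!sumrB; apply: eq_bigr => B _.
rewrite /is_cut finset.setD_eq0; case: eqP => [XB0|_] /=.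
  have -> : (X e \subset B) = false; last by rewrite /=; ring.
  apply/negbTE/negP => /fintype.subsetP/(_ v ve) vB.
  by move/setP/(_ v): XB0; rewrite !inE ve vB.
by case: (X e \subset B) => /=; ring.
Qed.

Lemma is_cut_set0 B e : X e = finset.set0 -> is_cut X B e = false.
Proof. by rewrite /is_cut => ->; rewrite finset.set0I eqxx. Qed.

Lemma cut_sizeE K B : (cut_size X K B)%:R = \sum_(e in K) (is_cut X B e)%:R :> R.
Proof.
rewrite /cut_size -sum1_card natr_sum big_mkcondr /=.
by apply: eq_bigr => e _; case: ifP.
Qed.

Lemma mean_cutE K : mean_cut X R K =
  \sum_B rounding (fun=> 0) B * (cut_size X K B)%:R.
Proof.
rewrite /mean_cut mulr_suml; apply: eq_bigr => B _; rewrite mulrC; congr (_ * _).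
rewrite /rounding (eq_bigr (fun=> 2^-1)) => [|v _]; last first.
  by rewrite addr0 subr0 mul1r if_same.
by rewrite prodr_const -cardsT -powersetT card_powerset cardsT natrX exprVn.
Qed.

(** For nonempty [A], the left side compares the probability of staying uncut under the rounding of
    [x] with that under the uniform cut. The empty set cancels against the uniform cut, and odd [S]
    cancel between the two products. *)
Lemma mono_excess_expand x (A : {set V}) :
  \prod_(v in A) ((1 + x v) / 2) + \prod_(v in A) ((1 - x v) / 2)
    - 2 * \prod_(v in A) (1 / 2) =
  2^-1 ^+ #|A| * \sum_(S : {set V} | (S \subset A) && (S != finset.set0))
    (1 + (-1) ^+ #|S|) * \prod_(v in S) x v.
Proof.
have half (F : V -> R) : \prod_(v in A) (F v / 2) =
    2^-1 ^+ #|A| * \prod_(v in A) F v.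
  by rewrite big_split /= prodr_const mulrC.
have expand (F : V -> R) : \prod_(v in A) (1 + F v) = 1 +
    \sum_(S : {set V} | (S \subset A) && (S != finset.set0)) \prod_(v in S) F v.
  under eq_bigr do rewrite addrC.
  rewrite prod_setD_expand (bigD1 finset.set0) ?finset.sub0set//=; congr (_ + _).
    by rewrite big1_eq big_set0 mul1r.
  by apply: eq_bigr => S _; rewrite big1_eq mulr1.
rewrite !half !expand big1_eq.
have -> : \sum_(S : {set V} | (S \subset A) && (S != finset.set0))
    \prod_(v in S) - x v = \sum_(S : {set V} | (S \subset A) && (S != finset.set0))
    (-1) ^+ #|S| * \prod_(v in S) x v.
  by apply: eq_bigr => S _; rewrite prodrN.
under [in RHS]eq_bigr do rewrite mulrDl mul1r.
by rewrite big_split /=; ring.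
Qed.

(** The best cut is at least as large as the expected cut under the rounding of [x], and the
    uniformly random cut is the rounding of the zero point. *)
Lemma surp_ge K x : (forall v, `|x v| <= 1) ->
  - \sum_(e in K) 2^-1 ^+ #|X e| *
     \sum_(S : {set V} | (S \subset X e) && (S != finset.set0))
        (1 + (-1) ^+ #|S|) * \prod_(v in S) x v <= surp X R K.
Proof.
move=> x1; have max_ge : \sum_B rounding x B * (cut_size X K B)%:R <=
    (\max_B cut_size X K B)%:R.
  rewrite -[leRHS]mul1r -[X in _ <= X * _](sum_rounding x) mulr_suml ler_sum// => B _.
  by rewrite ler_wpM2l ?rounding_ge0// ler_nat leq_bigmax.
apply: le_trans (lerB max_ge (lexx _)); rewrite mean_cutE.
have swap z : \sum_B rounding z B * (cut_size X K B)%:R =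
    \sum_(e in K) \sum_B rounding z B * (is_cut X B e)%:R.
  rewrite exchange_big; apply: eq_bigr => B _.
  by rewrite cut_sizeE mulr_sumr.
rewrite !swap -sumrB -sumrN le_eqVlt; apply/orP; left; apply/eqP.
apply: eq_bigr => e _; rewrite -mono_excess_expand.
(* An empty edge is never cut and contributes 0 on both sides. *)
case: (eqVneq (X e) finset.set0) => Xe.
  rewrite Xe !big_set0 mulr1 -[1 + 1 - 2]/(2 - 2) subrr oppr0 -sumrB big1// => B _.
  by rewrite !is_cut_set0// !mulr0 subr0.
rewrite !sum_rounding_is_cut//.
by rewrite /= addr0 subr0; ring.
Qed.

End Rounding.

(** * Local fields of a random edge set *)

Section RandomEdgeSet.
Variables (R : realType) (E : finType) (mu : {set E} -> R).
Hypotheses (mu_ge0 : forall K, 0 <= mu K) (mu_sum : \sum_K mu K = 1).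
Implicit Types (K : {set E}) (phi psi : {set E} -> R).

(** Expectation under a finite law on edge sets. Measure theory enters only when [mu] is specialised
    to the law of the random edge set. *)
Definition mean phi : R := \sum_K mu K * phi K.

Lemma eq_mean phi psi : phi =1 psi -> mean phi = mean psi.
Proof. by move=> e; apply: eq_bigr => K _; rewrite e. Qed.

Lemma meanD phi psi : mean (fun K => phi K + psi K) = mean phi + mean psi.
Proof. by rewrite -big_split /=; apply: eq_bigr => K _; rewrite mulrDr. Qed.

Lemma meanZl (x : R) phi : mean (fun K => x * phi K) = x * mean phi.
Proof. by rewrite mulr_sumr; apply: eq_bigr => K _; rewrite mulrCA. Qed.

Lemma meanN phi : mean (fun K => - phi K) = - mean phi.
Proof. by rewrite -sumrN; apply: eq_bigr => K _; rewrite mulrN. Qed.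

Lemma mean_sum (I : Type) (r : seq I) (P : pred I) (phi : I -> {set E} -> R) :
  mean (fun K => \sum_(i <- r | P i) phi i K) = \sum_(i <- r | P i) mean (phi i).
Proof.
rewrite /mean exchange_big; apply: eq_bigr => K _.
by rewrite mulr_sumr.
Qed.

Lemma mean_cst (x : R) : mean (fun=> x) = x.
Proof. by rewrite /mean -mulr_suml mu_sum mul1r. Qed.

Lemma le_mean phi psi : (forall K, phi K <= psi K) -> mean phi <= mean psi.
Proof. by move=> le; apply: ler_sum => K _; rewrite ler_wpM2l. Qed.

Lemma normr_mean_le phi (M : R) : (forall K, `|phi K| <= M) -> `|mean phi| <= M.
Proof.
move=> le; rewrite ler_norml -{1}(mean_cst M) -meanN -{2}(mean_cst M) !le_mean//.
  by move=> K; have := le K; rewrite ler_norml => /andP[].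
by move=> K; have := le K; rewrite ler_norml => /andP[].
Qed.

Definition has_edge (e : E) K : R := (e \in K)%:R.

Lemma has_edge_ge0 e K : 0 <= has_edge e K. Proof. exact: ler0n. Qed.

Lemma has_edge_le1 e K : has_edge e K <= 1.
Proof. by rewrite /has_edge lern1 leq_b1. Qed.

Definition centered (e : E) K : R := has_edge e K - mean (has_edge e).

Lemma mean_has_edge_ge0 e : 0 <= mean (has_edge e).
Proof. by rewrite -[leLHS](mean_cst 0) le_mean. Qed.

Lemma mean_has_edge_le1 e : mean (has_edge e) <= 1.
Proof. by rewrite -[leRHS](mean_cst 1) le_mean// => K; exact: has_edge_le1. Qed.

Lemma normr_centered_le1 e K : `|centered e K| <= 1.
Proof.
rewrite ler_norml /centered.
have := mean_has_edge_ge0 e; have := mean_has_edge_le1 e.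
by have := has_edge_ge0 e K; have := has_edge_le1 e K; lra.
Qed.

Lemma mean_centered e : mean (centered e) = 0.
Proof. by rewrite meanD mean_cst subrr. Qed.

(** Centred indicators of edges in [B] are thus functions of [K :&: B], the form in which
    independence is applied. *)
Lemma centered_setI e K (B : {set E}) : e \in B ->
  centered e (K :&: B) = centered e K.
Proof. by move=> eB; rewrite /centered /has_edge inE eB andbT. Qed.

End RandomEdgeSet.

Section LocalFields.
Variables (R : realType) (V E : finType) (X : E -> {set V}).
Variables (mu : {set E} -> R) (share : rel E) (Y : {set E}) (src dst : E -> V).
Variables (k D : nat) (eta Delta : R).
Hypotheses (mu_ge0 : forall K, 0 <= mu K) (mu_sum : \sum_K mu K = 1).
Hypothesis indep : forall A B : {set E},
  (forall e f, e \in A -> f \in B -> ~~ share e f) ->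
  forall phi psi : {set E} -> R,
    mean mu (fun K => phi (K :&: A) * psi (K :&: B)) =
    mean mu (fun K => phi (K :&: A)) * mean mu (fun K => psi (K :&: B)).
Hypothesis srcX : forall e, e \in Y -> src e \in X e.
Hypothesis dstX : forall e, e \in Y -> dst e \in X e.
Hypothesis src_dst : forall e, e \in Y -> src e != dst e.
Hypothesis sizeX : forall e, (#|X e| <= k)%N.
Hypothesis codeg : forall u v, u != v ->
  (#|[set e | (u \in X e) && (v \in X e)]| <= D)%N.
Hypothesis codeg_share : forall u e,
  (#|[set f | (u \in X f) && share e f]| <= k * D)%N.
Hypothesis deg : forall u, #|[set e | u \in X e]|%:R <= Delta.
Hypothesis share_sym : symmetric share.
Hypothesis eta_ge0 : 0 <= eta.

Implicit Types (K : {set E}) (B S U : {set V}) (u v t : V).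

Definition parallel v u : {set E} := [set f in Y | (dst f == v) && (src f == u)].

Definition coef K v u : R := eta * \sum_(f in parallel v u) centered mu f K.

Definition local_field K v (B : {set V}) : R := \sum_u coef K v u * sgn R B u.

Lemma card_parallel v u : (#|parallel v u| <= D)%N.
Proof.
case: (eqVneq u v) => [->|uv].
  rewrite (_ : parallel v v = finset.set0) ?cards0//; apply/setP => f.
  rewrite !inE; apply/negbTE/negP => /and3P[fY /eqP dv /eqP sv].
  by have := src_dst fY; rewrite dv sv eqxx.
apply: leq_trans (codeg uv); apply: subset_leq_card.
apply/fintype.subsetP => f; rewrite !inE => /and3P[fY /eqP <- /eqP <-].
by rewrite srcX// dstX.
Qed.

Lemma coef_le_card K v u : `|coef K v u| <= eta * #|parallel v u|%:R.
Proof.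
rewrite normrM (ger0_norm eta_ge0) ler_wpM2l//.
rewrite -[#|_|]sum1_card natr_sum (le_trans (ler_norm_sum _ _ _))// ler_sum// => f _.
exact: normr_centered_le1.
Qed.

Lemma coef_le K v u : `|coef K v u| <= eta * D%:R.
Proof.
by rewrite (le_trans (coef_le_card _ _ _))// ler_wpM2l// ler_nat card_parallel.
Qed.

Lemma sum_card_parallel v :
  (\sum_u #|parallel v u| = #|[set f in Y | dst f == v]|)%N.
Proof.
rewrite -sum1_card (partition_big src predT)//=; apply: eq_bigr => u _.
by rewrite -sum1_card; apply: eq_bigl => f; rewrite !inE andbA.
Qed.

Lemma sum_card_parallel_le v : \sum_u #|parallel v u|%:R <= Delta.
Proof.
rewrite -natr_sum sum_card_parallel; apply: le_trans (deg v); rewrite ler_nat.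
apply: subset_leq_card; apply/fintype.subsetP => f; rewrite !inE.
by move=> /andP[fY /eqP <-]; exact: dstX.
Qed.

Lemma sum_sum_card_parallel : (\sum_v \sum_u #|parallel v u| = #|Y|)%N.
Proof.
rewrite -sum1_card (partition_big dst predT)//=; apply: eq_bigr => v _.
by rewrite sum_card_parallel -sum1_card; apply: eq_bigl => f; rewrite !inE.
Qed.

Lemma mean_coef v u : mean mu (fun K => coef K v u) = 0.
Proof.
rewrite meanZl mean_sum big1 ?mulr0// => f _; exact: mean_centered.
Qed.

Lemma sum_local_field K S (c : V -> R) (B : {set V}) :
  \sum_(v in S) c v * local_field K v B =
  \sum_u (\sum_(v in S) c v * coef K v u) * sgn R B u.
Proof.
under eq_bigr do rewrite mulr_sumr.
rewrite exchange_big; apply: eq_bigr => u _.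
by rewrite mulr_suml; apply: eq_bigr => v _; rewrite mulrA.
Qed.

Lemma sum_coef_le K S (c : V -> R) u : (#|S| <= k)%N -> (forall v, `|c v| <= 1) ->
  `|\sum_(v in S) c v * coef K v u| <= k%:R * (eta * D%:R).
Proof.
move=> Sk c1; rewrite (le_trans (ler_norm_sum _ _ _))//.
apply: (@le_trans _ _ (\sum_(v in S) eta * D%:R)).
  by apply: ler_sum => v _; rewrite normrM -[leRHS]mul1r ler_pM ?c1 ?coef_le.
rewrite sumr_const -[leLHS]mulr_natl ler_wpM2r ?mulr_ge0//.
by rewrite ler_nat.
Qed.

(** * Averages over the signs of products of sines of local fields *)

Definition mixed K S U : R :=
  avg (fun B => (\prod_(u in U) sgn R B u) * \prod_(v in S) sin (local_field K v B)).

Lemma avg_half (h f g : {set V} -> R) :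
  avg (fun B => h B * ((f B - g B) / 2)) =
  (avg (fun B => h B * f B) - avg (fun B => h B * g B)) / 2.
Proof.
rewrite /avg -mulrBl mulrAC; congr (_ / _); rewrite -sumrB mulr_suml.
by apply: eq_bigr => B _; ring.
Qed.

(** Once the product is reduced to a single sine, the average factorises over the vertices, and a
    vertex of [U] contributes the sine of a combined coefficient, of order [eta]. *)
Lemma mixed_le K S U : (#|S| <= k)%N -> U != finset.set0 ->
  `|mixed K S U| <= k%:R * (eta * D%:R).
Proof.
move=> Sk /finset.set0Pn[u uU].
pose L (h : {set V} -> R) := avg (fun B => (\prod_(u in U) sgn R B u) * h B).
apply: (@sine_product_le _ _ _ L) => [f g|c theta c1]; first exact: avg_half.
rewrite /L; under eq_fun do rewrite sum_local_field.
rewrite avg_sgn_sin normrM (le_trans _ (sum_coef_le K u Sk c1))//.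
rewrite -[leRHS]mul1r ler_pM ?sin_max//.
rewrite (bigD1 u)//= uU normrM (le_trans _ (normr_sin_le _))//.
by rewrite ler_piMr// prod_norm_le1// => w _; case: ifP; rewrite ?sin_max ?cos_max.
Qed.

Lemma mixed_single K v U : mixed K [set v] U = sin (pi / 2 * #|U|%:R) *
  \prod_u (if u \in U then sin (coef K v u) else cos (coef K v u)).
Proof.
rewrite -[pi / 2 * _]add0r -avg_sgn_sin; congr avg; apply/funext => B.
by rewrite big_set1 addr0.
Qed.

(** Two leftover signs produce two small sine factors. *)
Lemma mixed_single_le K v U : (1 < #|U|)%N ->
  `|mixed K [set v] U| <= (eta * D%:R) ^+ 2.
Proof.
move=> /card_gt1P[u [w [uU wU uw]]]; rewrite mixed_single normrM.
rewrite -[leRHS]mul1r ler_pM ?sin_max//.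
rewrite (bigD1 u)//= (bigD1 w)/= 1?eq_sym// uU wU !normrM expr2.
rewrite ler_pM ?mulr_ge0// ?(le_trans (normr_sin_le _)) ?coef_le//.
rewrite -[leRHS]mulr1 ler_pM ?(le_trans (normr_sin_le _)) ?coef_le//.
by rewrite prod_norm_le1// => z _; case: ifP; rewrite ?sin_max ?cos_max.
Qed.

Lemma mixed_pair K v u : mixed K [set v] [set u] =
  sin (coef K v u) * \prod_(w | w != u) cos (coef K v w).
Proof.
rewrite mixed_single cards1 mulr1 sin_pihalf mul1r (bigD1 u)//= set11.
by congr (_ * _); apply: eq_bigr => w wu; rewrite inE (negbTE wu).
Qed.

Lemma mixed_set0 K U : U != finset.set0 -> mixed K finset.set0 U = 0.
Proof.
move=> /finset.set0Pn[u uU].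
(* Zero coefficients with phase [pi / 2] make the sine constantly 1, so a bare product of signs fits
   [avg_sgn_sin]. *)
transitivity (avg (fun B => (\prod_(u in U) sgn R B u) *
    sin (\sum_(u : V) (fun=> 0) u * sgn R B u + pi / 2))).
  congr avg; apply/funext => B; rewrite big_set0 [X in sin (X + _)]big1.
    by rewrite add0r sin_pihalf.
  by move=> w _; rewrite mul0r.
by rewrite avg_sgn_sin (bigD1 u)//= uU sin0 mul0r mulr0.
Qed.

Lemma coef_setI K (B : {set E}) v u : parallel v u \subset B -> coef (K :&: B) v u = coef K v u.
Proof.
move=> sub; congr (_ * _); apply: eq_bigr => f fp.
by rewrite centered_setI// (fintype.subsetP sub).
Qed.

Lemma coef_setI_le K (B : {set E}) v u :
  `|coef K v u - coef (K :&: B) v u| <= eta * #|parallel v u :\: B|%:R.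
Proof.
rewrite -mulrBr normrM (ger0_norm eta_ge0) ler_wpM2l// -sumrB.
rewrite (le_trans (ler_norm_sum _ _ _))// -[#|_|]sum1_card natr_sum.
rewrite big_mkcond [leRHS]big_mkcond; apply: ler_sum => f _; rewrite !inE.
case: (boolP (f \in Y)) => //= _; last by rewrite andbF.
case: (_ && _) => //=; last by rewrite andbF.
case: (boolP (f \in B)) => /= [fB|fB]; first by rewrite centered_setI// subrr normr0.
rewrite /centered /has_edge inE (negbTE fB) andbF opprD addrACA subrr addr0 subr0.
by case: (f \in K); rewrite ?normr1 ?normr0.
Qed.

(** * Pairs of edges that share a random variable *)

Definition clash_at v w t : nat :=
  (\sum_(f in parallel v t) #|[set g in parallel w t | share f g]|)%N.

Definition clash v w : nat := (\sum_t clash_at v w t)%N.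

(** Fix [f] in [Y] with source [t]. Every [g] counted with it contains [t] and shares a variable
    with [f], which leaves [k * D] choices, and [g] determines [w] as its [dst]. *)
Lemma sum_clash : (\sum_v \sum_w clash v w <= #|Y| * (k * D))%N.
Proof.
rewrite -sum_sum_card_parallel big_distrl leq_sum//= => v _.
rewrite exchange_big big_distrl leq_sum//= => t _.
rewrite exchange_big -sum_nat_const leq_sum//= => f fp.
apply: leq_trans (codeg_share t f).
rewrite -sum1_card (partition_big dst predT)//=; apply: leq_sum => w _.
rewrite -sum1_card [leqRHS]big_mkcond [leqLHS]big_mkcond; apply: leq_sum => g _.
rewrite !inE; case: ifP => // /andP[/and3P[gY /eqP <- /eqP <-] ->].
by rewrite srcX// eqxx.
Qed.

Lemma sum_share_parallel v e :
  (\sum_t #|[set f in parallel v t | share e f]| <= k * D)%N.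
Proof.
apply: leq_trans (codeg_share v e).
rewrite -sum1_card (partition_big src predT)//=; apply: leq_sum => t _.
rewrite -sum1_card [leqRHS]big_mkcond [leqLHS]big_mkcond; apply: leq_sum => g _.
rewrite !inE; case: ifP => // /andP[/and3P[gY /eqP <- /eqP <-] ->].
by rewrite dstX// eqxx.
Qed.

(** * Averages without leftover signs, telescoped over the vertices *)

Lemma avg_sin (c : V -> R) (theta : R) :
  avg (fun B => sin (\sum_u c u * sgn R B u + theta)) = sin theta * \prod_u cos (c u).
Proof.
have := avg_sgn_sin finset.set0 c theta; rewrite cards0 mulr0 addr0.
under [in RHS]eq_bigr do rewrite inE.
by move=> <-; congr avg; apply/funext => B; rewrite big_set0 mul1r.
Qed.

Definition signed_coef K S (c : V -> R) u : R := \sum_(w in S) c w * coef K w u.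

(** With one sine kept apart, the product-to-sum formula leaves two pure sines. Their averages are
    products of cosines carrying the common phase factor [cos theta]. *)
Lemma avg_sin_sin K v S (c : V -> R) (theta : R) :
  avg (fun B => sin (local_field K v B) *
                sin (\sum_(w in S) c w * local_field K w B + theta)) =
  cos theta / 2 * (\prod_u cos (coef K v u - signed_coef K S c u) -
                   \prod_u cos (coef K v u + signed_coef K S c u)).
Proof.
transitivity (avg (fun B => 1 * ((
    sin (\sum_u (coef K v u - signed_coef K S c u) * sgn R B u + (pi / 2 - theta)) -
    sin (\sum_u (coef K v u + signed_coef K S c u) * sgn R B u + (pi / 2 + theta)))
    / 2))).
  congr avg; apply/funext => B; rewrite mul_sin_sin mul1r sum_local_field.
  have -> : \sum_u (coef K v u - signed_coef K S c u) * sgn R B u =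
      local_field K v B - \sum_u signed_coef K S c u * sgn R B u.
    by rewrite -sumrB; apply: eq_bigr => u _; rewrite mulrBl.
  have -> : \sum_u (coef K v u + signed_coef K S c u) * sgn R B u =
      local_field K v B + \sum_u signed_coef K S c u * sgn R B u.
    by rewrite -big_split; apply: eq_bigr => u _; rewrite mulrDl.
  by congr ((sin _ - sin _) / 2); rewrite /signed_coef; ring.
rewrite avg_half; under eq_fun do rewrite mul1r.
under [X in _ - avg X]eq_fun do rewrite mul1r.
rewrite !avg_sin ![pi / 2 + _]addrC !sinDpihalf cosN.
by ring.
Qed.

(** The cofactor of [t] in the telescoped difference; [h t u] selects which of the two cosine
    products supplies the factor at [u]. *)
Definition site_weight (h : V -> V -> bool) K v S c t : R :=
  \prod_(u | u != t) cos (coef K v u + (-1) ^+ h t u * signed_coef K S c u).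

(** At the switched site [cos (a - b) - cos (a + b)] equals [2 * (sin a * sin b)], so every term
    carries two factors of order [eta]. *)
Lemma prod_cos_telescope : exists h : V -> V -> bool, forall K v S c,
  \prod_u cos (coef K v u - signed_coef K S c u) -
  \prod_u cos (coef K v u + signed_coef K S c u) =
  2 * \sum_t sin (coef K v t) * sin (signed_coef K S c t) * site_weight h K v S c t.
Proof.
have [h hE] := prodB_telescope R (index_enum_uniq V).
exists h => K v S c; rewrite hE mulr_sumr; apply: eq_bigr => t _.
rewrite cosB cosD; have -> a b x y : a * b + x * y - (a * b - x * y) = 2 * (x * y) :> R.
  by ring.
rewrite -!mulrA; congr (_ * (_ * (_ * _))); apply: eq_bigr => u _.
by case: (h t u); rewrite ?expr1 ?expr0 ?mulN1r ?mul1r.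
Qed.

Lemma site_weight_le1 h K v S c t : `|site_weight h K v S c t| <= 1.
Proof. by apply: prod_norm_le1 => u _; exact: cos_max. Qed.

(** Cosines are bounded by 1 and 1-Lipschitz, so the change is at most the total change of the
    coefficients, which only edges of [Y] outside [B] pointing into [v |: S] can cause. *)
Lemma site_weight_setI_le h K (B : {set E}) v S c t :
  (forall w, `|c w| <= 1) -> v \notin S ->
  `|site_weight h K v S c t - site_weight h (K :&: B) v S c t|
    <= eta * (\sum_(w in v |: S) #|[set g in Y | dst g == w] :\: B|)%:R.
Proof.
move=> c1 vS.
pose F L u := cos (coef L v u + (-1) ^+ h t u * signed_coef L S c u).
have F1 L u : u != t -> `|F L u| <= 1 by rewrite cos_max.
apply: le_trans (prodB_norm_le _ (F1 K) (F1 (K :&: B))) _.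
apply: (@le_trans _ _ (\sum_u \sum_(w in v |: S) `|coef K w u - coef (K :&: B) w u|)).
  rewrite big_mkcond; apply: ler_sum => u _; case: ifP => _; last first.
    by apply: sumr_ge0.
  rewrite (le_trans (cos_lipschitz _ _))// big_setU1//=.
  have -> (a b s x y : R) : a + s * x - (b + s * y) = (a - b) + s * (x - y) by ring.
  rewrite (le_trans (ler_normD _ _))// lerD2l normrM normrX normrN1 expr1n mul1r.
  rewrite /signed_coef -sumrB (le_trans (ler_norm_sum _ _ _))// ler_sum// => w _.
  by rewrite -mulrBr normrM ler_piMl.
rewrite exchange_big natr_sum mulr_sumr; apply: ler_sum => w _.
apply: (@le_trans _ _ (\sum_u eta * #|parallel w u :\: B|%:R)).
  by apply: ler_sum => u _; exact: coef_setI_le.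
rewrite -mulr_sumr ler_wpM2l// -natr_sum ler_nat.
rewrite -sum1_card (partition_big src predT)//= leq_sum// => u _.
rewrite -sum1_card [leqRHS]big_mkcond [leqLHS]big_mkcond; apply: leq_sum => g _.
by rewrite !inE; case: (g \in B) => //=; case: (g \in Y) => //=; case: (_ && _).
Qed.

Definition site_const : R := k%:R * D%:R ^+ 2 + k%:R ^+ 3 * D%:R ^+ 3.

(** The two sines give order [eta ^+ 2]. A third [eta] comes from independence: [coef K v t] has
    mean zero, so once it is separated from the other factors only its quadratic error survives.
    Sites where separation fails are charged the trivial bound, weighted by the number of shared
    variables found there. *)
Lemma site_le h e v S c t : v \in X e -> S \subset X e -> v \notin S ->
  (forall w, `|c w| <= 1) ->
  `|mean mu (fun K => has_edge R e K * (sin (coef K v t) *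
      sin (signed_coef K S c t) * site_weight h K v S c t))| <=
  #|parallel v t|%:R * (site_const * eta ^+ 3) +
  (#|[set f in parallel v t | share e f]| + \sum_(w in S) clash_at v w t)%:R *
  (k%:R * D%:R ^+ 2 * eta ^+ 2).
Proof.
move=> vX SX vS c1; have Sk : (#|S| <= k)%N.
  exact: leq_trans (subset_leq_card SX) (sizeX e).
have vSk : (#|v |: S| <= k)%N.
  by apply: leq_trans (sizeX e); apply: subset_leq_card; rewrite finset.subUset finset.sub1set vX.
have kD_ge0 : 0 <= k%:R * (eta * D%:R) by rewrite !mulr_ge0.
have sin_s K : `|sin (signed_coef K S c t)| <= k%:R * (eta * D%:R).
  by rewrite (le_trans (normr_sin_le _))// sum_coef_le.
have edge1 K : `|has_edge R e K| <= 1.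
  by rewrite ger0_norm ?has_edge_ge0 ?has_edge_le1.
have site_ge0 : 0 <= site_const * eta ^+ 3.
  by rewrite mulr_ge0 ?exprn_ge0 ?addr_ge0 ?mulr_ge0 ?exprn_ge0.
(* At a bad site the count is at least 1, so one copy of the trivial bound is available. *)
have [bad|] := ltnP 0 (#|[set f in parallel v t | share e f]| + \sum_(w in S) clash_at v w t).
  apply: (@le_trans _ _ (1 * (k%:R * D%:R ^+ 2 * eta ^+ 2))); last first.
    apply: ler_wpDl; first exact: mulr_ge0.
    by apply: ler_wpM2r; rewrite ?ler1n// !mulr_ge0 ?exprn_ge0.
  rewrite mul1r (_ : _ * _ * _ = 1 * ((eta * D%:R) * (k%:R * (eta * D%:R)) * 1)); last by ring.
  apply: normr_mean_le => // K; rewrite !normrM.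
  rewrite ler_pM ?mulr_ge0// ler_pM ?mulr_ge0 ?site_weight_le1// ler_pM//.
  by rewrite (le_trans (normr_sin_le _))// coef_le.
rewrite leqn0 addn_eq0 => /andP[/eqP noe /eqP noS].
rewrite noe noS addn0 mul0r addr0.
(* [A] determines [coef K v t], and [B] collects the edges sharing no variable with [A]. As the site
   is good, [B] contains [e] and all edges of [Y] from [t] into [S]. *)
pose A := parallel v t; pose B := [set g | [forall f in A, ~~ share f g]].
have AB f g : f \in A -> g \in B -> ~~ share f g.
  by move=> fA; rewrite inE => /forall_inP/(_ f fA).
have eB : e \in B.
  rewrite inE; apply/forall_inP => f fA; rewrite share_sym; apply/negP => ef.
  by move/eqP: noe; rewrite cards_eq0 => /eqP/setP/(_ f);
    rewrite finset.in_set ef [f \in _]fA finset.in_set0.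
have SB w : w \in S -> parallel w t \subset B.
  move=> wS; apply/fintype.subsetP => g gp; rewrite inE; apply/forall_inP => f fA.
  apply/negP => fg; move/eqP: noS; rewrite sum_nat_eq0 => /forall_inP/(_ w wS).
  rewrite sum_nat_eq0 => /forall_inP/(_ f fA); rewrite cards_eq0 => /eqP/setP/(_ g).
  by rewrite finset.in_set gp fg finset.in_set0.
(* There are at most [k] heads [w] and at most [D] edges in [A], and each of these shares a variable
   with at most [k * D] edges at [w]. *)
have notB : (\sum_(w in v |: S) #|[set g in Y | dst g == w] :\: B| <= k * (D * (k * D)))%N.
  apply: (@leq_trans (\sum_(w in v |: S) D * (k * D))); last first.
    by rewrite sum_nat_const leq_mul.
  apply: leq_sum => w _; apply: (@leq_trans (\sum_(f in A) k * D)); last first.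
    by rewrite sum_nat_const leq_mul ?card_parallel.
  apply: leq_trans (_ : \sum_(f in A) #|[set g | (w \in X g) && share f g]| <= _)%N; last first.
    by apply: leq_sum => f _; exact: codeg_share.
  apply: leq_trans (_ : #|\bigcup_(f in A) [set g | (w \in X g) && share f g]| <= _)%N; last first.
    elim/big_ind2: _ => [|s m s' m' sm sm'|//]; first by rewrite cards0.
    by apply: leq_trans (leq_add sm sm'); rewrite cardsU leq_subr.
  apply: subset_leq_card; apply/fintype.subsetP => g; rewrite !inE.
  case/and3P => /forall_inPn[f fA]; rewrite negbK => fg gY /eqP gw.
  by apply/bigcupP; exists f => //; rewrite inE fg -gw dstX.
pose Psi K := has_edge R e K * sin (signed_coef K S c t) * site_weight h K v S c t.
have edgeB K : has_edge R e (K :&: B) = has_edge R e K.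
  by rewrite /has_edge inE eB andbT.
have sB K : signed_coef (K :&: B) S c t = signed_coef K S c t.
  by apply: eq_bigr => w wS; rewrite coef_setI ?SB.
have bA K : coef (K :&: A) v t = coef K v t by rewrite coef_setI.
(* The cofactor is replaced by its value at [K :&: B]. The first term then factorises by [indep];
   the second has three factors of order [eta], the last being the change of the cofactor. *)
have -> : mean mu (fun K => has_edge R e K * (sin (coef K v t) *
      sin (signed_coef K S c t) * site_weight h K v S c t)) =
    mean mu (fun K => sin (coef K v t)) * mean mu (fun K => Psi (K :&: B)) +
    mean mu (fun K => has_edge R e K * (sin (coef K v t) * sin (signed_coef K S c t) *
      (site_weight h K v S c t - site_weight h (K :&: B) v S c t))).
  have -> : mean mu (fun K => sin (coef K v t)) = mean mu (fun K => sin (coef (K :&: A) v t)).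
    by apply: eq_mean => K; rewrite bA.
  rewrite -(indep AB (fun K => sin (coef K v t)) Psi) -meanD; apply: eq_mean => K.
  by rewrite /Psi bA edgeB sB; ring.
pose n : R := #|A|%:R.
have msin : `|mean mu (fun K => sin (coef K v t))| <= n * (eta ^+ 2 * D%:R).
  (* The linear part has mean zero and can be subtracted freely. *)
  have -> : mean mu (fun K => sin (coef K v t)) =
      mean mu (fun K => sin (coef K v t) - coef K v t).
    by rewrite meanD meanN mean_coef subr0.
  apply: normr_mean_le => // K; rewrite (le_trans (sin_sub_le _))//.
  rewrite -real_normK ?num_real// (_ : n * _ = (eta * n) * (eta * D%:R)); last by ring.
  by rewrite expr2 ler_pM ?coef_le ?coef_le_card.
have mPsi : `|mean mu (fun K => Psi (K :&: B))| <= k%:R * (eta * D%:R).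
  apply: normr_mean_le => // K; rewrite !normrM -[leRHS]mulr1 ler_pM ?mulr_ge0//.
    by rewrite -[leRHS]mul1r ler_pM.
  exact: site_weight_le1.
have -> : #|parallel v t|%:R * (site_const * eta ^+ 3) =
    n * (eta ^+ 2 * D%:R) * (k%:R * (eta * D%:R)) +
    1 * ((eta * n) * (k%:R * (eta * D%:R)) * (eta * (k * (D * (k * D)))%:R)).
  by rewrite /site_const /n /A !natrM; ring.
rewrite (le_trans (ler_normD _ _))// lerD//; first by rewrite normrM ler_pM.
apply: normr_mean_le => // K; rewrite !normrM ler_pM ?mulr_ge0//.
rewrite ler_pM ?mulr_ge0//; last first.
  by rewrite (le_trans (site_weight_setI_le _ _ _ _ c1 vS))// ler_wpM2l// ler_nat.
by rewrite ler_pM// (le_trans (normr_sin_le _))// coef_le_card.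
Qed.

(** * Error terms and gain when the parameters are small *)

Variables (eps vmin tau : R).
Hypothesis eta_le : eta <= eps.
Hypothesis eta_Delta : eta ^+ 2 * Delta <= eps.
Hypothesis eps_le1 : eps <= 1.
Hypothesis correl : forall e f, mean mu (has_edge R e) * mean mu (has_edge R f) <=
  mean mu (fun K => has_edge R e K * has_edge R f K).
Hypothesis var : forall e, e \in Y ->
  vmin <= mean mu (has_edge R e) * (1 - mean mu (has_edge R e)).
Hypothesis tau_ge0 : 0 <= tau.
Hypothesis tau_le : tau <= 2^-1.

(** Sums [site_le] over all sites. Since [eta ^+ 2 * Delta <= 1], the cubic terms add up to order
    [eta]; the shared-variable terms are controlled by [sum_share_parallel] and the clashes, with a
    factor [eta] to spare. *)
Lemma mixed_full_le e S v : S \subset X e -> v \in S ->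
  `|mean mu (fun K => has_edge R e K * mixed K S finset.set0)| <=
  eta * (site_const + (k * D + \sum_(w in X e | w != v) clash v w)%:R *
                      (k%:R * D%:R ^+ 2)).
Proof.
move=> SX vS; pose S' := S :\ v.
have vS' : v \notin S' by rewrite !inE eqxx.
have S'X : S' \subset X e by apply: fintype.subset_trans SX; exact: subD1set.
have vX : v \in X e by exact: (fintype.subsetP SX).
(* [L] acts on functions of the pair of edge set and signs, so that the remaining sines are
   linearised under both averages at once. *)
pose L (h : {set E} * {set V} -> R) := mean mu (fun K => has_edge R e K *
  avg (fun B => sin (local_field K v B) * h (K, B))).
pose F w (p : {set E} * {set V}) := local_field p.1 w p.2.
have -> : mean mu (fun K => has_edge R e K * mixed K S finset.set0) =
    L (fun p => \prod_(w in S') sin (F w p)).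
  apply: eq_mean => K; congr (_ * avg _); apply/funext => B.
  by rewrite big_set0 mul1r (big_setD1 v vS).
apply: sine_product_le => [f g|c theta c1].
  rewrite /L [RHS]mulrC -meanN -meanD -meanZl; apply: eq_mean => K.
  by rewrite avg_half; ring.
have [h hE] := prod_cos_telescope.
have -> : L (fun p => sin (\sum_(w in S') c w * F w p + theta)) =
    cos theta * \sum_t mean mu (fun K => has_edge R e K * (sin (coef K v t) *
      sin (signed_coef K S' c t) * site_weight h K v S' c t)).
  rewrite -mean_sum -meanZl; apply: eq_mean => K.
  by rewrite avg_sin_sin hE -mulr_sumr; field.
rewrite normrM -[leRHS]mul1r ler_pM ?cos_max// (le_trans (ler_norm_sum _ _ _))//.
apply: (@le_trans _ _ (\sum_t (#|parallel v t|%:R * (site_const * eta ^+ 3) +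
  (#|[set f in parallel v t | share e f]| + \sum_(w in S') clash_at v w t)%:R *
  (k%:R * D%:R ^+ 2 * eta ^+ 2)))).
  by apply: ler_sum => t _; exact: site_le.
rewrite big_split /= -!mulr_suml mulrDr lerD//.
  rewrite (_ : _ * _ = eta * site_const * (eta ^+ 2 * \sum_t #|parallel v t|%:R));
    last by ring.
  rewrite -[leRHS]mulr1 ler_wpM2l//.
    by rewrite mulr_ge0// addr_ge0// mulr_ge0 ?exprn_ge0.
  apply: le_trans (le_trans eta_Delta eps_le1).
  by rewrite ler_wpM2l ?exprn_ge0 ?sum_card_parallel_le.
rewrite -natr_sum; set N1 := (\sum_t _)%N; set N2 := (_ + _)%N.
have N12 : (N1 <= N2)%N.
  rewrite /N1 big_split /= leq_add ?sum_share_parallel//.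
  rewrite exchange_big /= [leqRHS]big_mkcond [leqLHS]big_mkcond leq_sum// => w _.
  by rewrite !inE; case: eqP => //= _; case: ifP => // /(fintype.subsetP SX) ->.
apply: (@le_trans _ _ (N2%:R * (k%:R * D%:R ^+ 2 * eta ^+ 2))).
  by rewrite ler_wpM2r ?ler_nat// !mulr_ge0 ?exprn_ge0.
rewrite (_ : _ * _ = eta * (N2%:R * (k%:R * D%:R ^+ 2)) * eta); last by ring.
by rewrite ler_piMr ?(le_trans eta_le)// !mulr_ge0 ?exprn_ge0.
Qed.

(** The average is its linearisation up to a relative error of order [eps]: [sin a - a] is
    quadratic, and the squared coefficients at [v] sum to at most [D * eps], which bounds the
    distance of the cosine product from 1. *)
Lemma pair_weight_le K v u :
  `|sin (coef K v u) * \prod_(w | w != u) cos (coef K v w) - coef K v u| <=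
  eta * #|parallel v u|%:R * (2 * D%:R * eps).
Proof.
set a := coef K v u; set P := \prod_(w | w != u) _.
have P1 : `|P - 1| <= D%:R * eps.
  have cos1 w : w != u -> `|cos (coef K v w)| <= 1 by rewrite cos_max.
  have one1 w : w != u -> `|1 : R| <= 1 by rewrite normr1.
  have := prodB_norm_le (index_enum V) cos1 one1; rewrite big1_eq => /le_trans; apply.
  apply: (@le_trans _ _ (\sum_w eta ^+ 2 * D%:R * #|parallel v w|%:R)).
    rewrite big_mkcond; apply: ler_sum => w _; case: ifP => _; last first.
      by rewrite !mulr_ge0 ?exprn_ge0.
    rewrite (le_trans (cos_sub1_le _))// -real_normK ?num_real// expr2.
    rewrite (_ : _ * _ * _ = (eta * D%:R) * (eta * #|parallel v w|%:R)); last by ring.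
    by rewrite ler_pM ?coef_le ?coef_le_card.
  rewrite -mulr_sumr mulrAC mulrC ler_wpM2l// (le_trans _ eta_Delta)//.
  by rewrite ler_wpM2l ?exprn_ge0 ?sum_card_parallel_le.
have -> : sin a * P - a = (sin a - a) + sin a * (P - 1) by ring.
rewrite (le_trans (ler_normD _ _))//.
rewrite (_ : _ * (2 * _ * _) = eta * #|parallel v u|%:R * (D%:R * eps) +
   eta * #|parallel v u|%:R * (D%:R * eps)); last by ring.
rewrite lerD//.
  rewrite (le_trans (sin_sub_le _))// -real_normK ?num_real// expr2.
  rewrite ler_pM ?coef_le_card// (le_trans (coef_le _ _ _))// mulrC.
  by rewrite ler_wpM2l.
by rewrite normrM ler_pM// (le_trans (normr_sin_le _))// coef_le_card.
Qed.

(** To first order the right side is a weighted sum of covariances of [e] with the edges [f] in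
    [parallel v u]. All are nonnegative by [correl], so only [e = f] is kept, where the variance is
    at least [vmin]. *)
Lemma pair_gain v u : v != u ->
  eta * #|parallel v u|%:R * (2^-1 ^+ k * vmin - 2 * D%:R ^+ 2 * eps) <=
  \sum_(e | (v \in X e) && (u \in X e)) 2^-1 ^+ #|X e| *
     mean mu (fun K => has_edge R e K * mixed K [set v] [set u]).
Proof.
move=> vu; pose n : R := #|parallel v u|%:R.
pose cov e f := mean mu (fun K => has_edge R e K * centered mu f K).
have covE e f : cov e f = mean mu (fun K => has_edge R e K * has_edge R f K) -
    mean mu (has_edge R e) * mean mu (has_edge R f).
  rewrite [X in _ - X]mulrC -meanZl -meanN -meanD; apply: eq_mean => K.
  by rewrite /centered; ring.
have cov_ge0 e f : 0 <= cov e f by rewrite covE subr_ge0.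
have covff f : f \in Y -> vmin <= cov f f.
  move=> fY; rewrite (le_trans (var fY))// covE mulrBr mulr1 lerB//.
  by apply: le_mean => // K; rewrite /has_edge; case: (f \in K); rewrite ?mulr1 ?mulr0.
have eps_ge0 : 0 <= eps by exact: le_trans eta_le.
have half_le1 m : 2^-1 ^+ m <= 1 :> R.
  by rewrite exprn_ile1 ?invr_ge0// invf_le1// ler1n.
have half_ge0 m : 0 <= 2^-1 ^+ m :> R by rewrite exprn_ge0 ?invr_ge0.
rewrite mulrBr; apply: (@le_trans _ _
  (\sum_(e | (v \in X e) && (u \in X e)) (2^-1 ^+ #|X e| *
     (eta * \sum_(f in parallel v u) cov e f) - eta * n * (2 * D%:R * eps)))).
  rewrite sumrB lerB//; last first.
    rewrite sumr_const -[leLHS]mulr_natl.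
    rewrite [leRHS](_ : _ = D%:R * (eta * n * (2 * D%:R * eps))); last by rewrite /n; ring.
    rewrite ler_wpM2r ?mulr_ge0// ler_nat.
    by apply: leq_trans (codeg vu); rewrite cardsE.
  under eq_bigr do rewrite mulrCA.
  rewrite -mulr_sumr -mulrA ler_wpM2l//.
  under eq_bigr do rewrite mulr_sumr.
  rewrite exchange_big /= -[#|_|]sum1_card natr_sum mulr_suml ler_sum// => f fp.
  move: (fp); rewrite inE => /and3P[fY /eqP fv /eqP fu].
  rewrite (bigD1 f) /=; last by rewrite -fv -fu dstX// srcX.
  rewrite mul1r ler_wpDr ?sumr_ge0// => [e _|]; first by rewrite mulr_ge0.
  apply: (@le_trans _ _ (2^-1 ^+ k * cov f f)).
    by rewrite ler_wpM2l// covff.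
  by rewrite ler_wpM2r// ler_wiXn2l ?invr_ge0 ?invf_le1 ?ler1n ?sizeX.
apply: ler_sum => e _.
have -> : eta * \sum_(f in parallel v u) cov e f =
    mean mu (fun K => has_edge R e K * coef K v u).
  by rewrite -mean_sum -meanZl; apply: eq_mean => K; rewrite -mulr_sumr mulrCA.
have main : mean mu (fun K => has_edge R e K * coef K v u) - eta * n * (2 * D%:R * eps) <=
    mean mu (fun K => has_edge R e K * mixed K [set v] [set u]).
  rewrite lerBlDr -lerBlDl -meanN -meanD (le_trans (ler_norm _))//.
  apply: normr_mean_le => // K; rewrite -mulrBr normrM -[leRHS]mul1r ler_pM//.
    by rewrite ger0_norm ?has_edge_ge0 ?has_edge_le1.
  by rewrite distrC mixed_pair pair_weight_le.
apply: (@le_trans _ _ (2^-1 ^+ #|X e| * (mean mu (fun K => has_edge R e K * coef K v u)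
  - eta * n * (2 * D%:R * eps)))); last by rewrite ler_wpM2l.
by rewrite mulrBr lerB// ler_piMl// !mulr_ge0.
Qed.

(** * Expansion of the surplus at the cut point *)

Definition cut_point K B v : R := - tau * sin (local_field K v B) + 2^-1 * sgn R B v.

Lemma cut_point_le1 K B v : `|cut_point K B v| <= 1.
Proof.
rewrite (le_trans (ler_normD _ _))// !normrM normrN (ger0_norm tau_ge0).
rewrite normr_sgn mulr1 (ger0_norm (_ : 0 <= 2^-1)) ?invr_ge0//.
have : tau * `|sin (local_field K v B)| <= tau by rewrite ler_piMr ?sin_max.
by have := tau_le; lra.
Qed.

(** [J] marks the vertices of [S] at which the sine summand of [cut_point] is chosen. The parity
    factor vanishes for odd [S]. *)
Definition expansion_coef S (J : {set V}) : R :=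
  - ((1 + (-1) ^+ #|S|) * ((- tau) ^+ #|J| * 2^-1 ^+ #|S :\: J|)).

(** [surp_ge] holds for every choice of signs, hence also on average over them, since the surplus
    does not depend on the signs. *)
Lemma surp_ge_mixed K :
  \sum_e 2^-1 ^+ #|X e| *
    \sum_(S : {set V} | (S \subset X e) && (S != finset.set0))
    \sum_(J : {set V} | J \subset S)
      expansion_coef S J * (has_edge R e K * mixed K J (S :\: J)) <= surp X R K.
Proof.
apply: le_trans (_ : avg (fun B => - \sum_(e in K) 2^-1 ^+ #|X e| *
     \sum_(S : {set V} | (S \subset X e) && (S != finset.set0))
        (1 + (-1) ^+ #|S|) * \prod_(v in S) cut_point K B v) <= _); last first.
  rewrite -[leRHS](@avg_cst R V) ler_wpM2r ?invr_ge0// ler_sum// => B _.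
  by apply: surp_ge => v; exact: cut_point_le1.
rewrite avgN avg_sum -sumrN [leRHS]big_mkcond ler_sum// => e _.
rewrite /has_edge; case: (e \in K); last first.
  rewrite big1 ?mulr0// => S _; rewrite big1// => J _; by rewrite mul0r mulr0.
rewrite avgZl -mulrN ler_wpM2l ?exprn_ge0 ?invr_ge0//.
rewrite avg_sum -sumrN ler_sum// => S _.
rewrite avgZl.
under [X in - (_ * avg X)]eq_fun do rewrite prod_setD_expand.
rewrite avg_sum mulr_sumr -sumrN ler_sum// => J _.
rewrite mul1r /expansion_coef mulNr lerN2 -mulrA ler_wpM2l//.
  by rewrite -signr_odd; case: (odd _); rewrite ?expr1 ?subrr ?expr0.
rewrite /mixed -avgZl le_eqVlt; apply/orP; left; apply/eqP; congr avg.
apply/funext => B; rewrite !big_split /= !prodr_const; ring.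
Qed.

Definition edge_mixed e J U : R := mean mu (fun K => has_edge R e K * mixed K J U).

(** A two-element set with one marked vertex is an ordered pair of distinct vertices, the marked one
    first. *)
Lemma sum_edge_pairs e (G : {set V} -> {set V} -> R) :
  \sum_(S : {set V} | (S \subset X e) && (S != finset.set0))
    \sum_(J : {set V} | J \subset S)
      (if (#|S| == 2%N) && (#|J| == 1%N) then G S J else 0) =
  \sum_(v in X e) \sum_(u in X e | u != v) G [set v; u] [set v].
Proof.
rewrite pair_big_dep [RHS]pair_big_dep /=.
pose A := [set p : V * V | (p.1 \in X e) && ((p.2 \in X e) && (p.2 != p.1))].
pose h (p : V * V) := ([set p.1; p.2] : {set V}, [set p.1] : {set V}).
have hinj : {in A &, injective h}.
  move=> [v u] [v' u']; rewrite !inE /= => /and3P[_ _ uv] /and3P[_ _ uv'].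
  case=> /setP E1 /finset.set1_inj E2; subst v'.
  by have := E1 u; rewrite !inE eqxx (negbTE uv) orbT /= => /esym/eqP ->.
transitivity (\sum_(p in A) G [set p.1; p.2] [set p.1]); last first.
  by apply: eq_bigl => p; rewrite inE.
rewrite -(big_imset (fun p => G p.1 p.2) hinj) /= -big_mkcondr /=.
apply: eq_bigl => -[S J] /=; apply/idP/imsetP => [|[[v u]]].
  case/andP => /andP[/andP[SX _] JS] /andP[/cards2P[a [b [ab ES]]] /cards1P[v EJ]].
  move: SX JS; rewrite EJ ES finset.sub1set finset.subUset !finset.sub1set !inE.
  case/andP => aX bX /orP[/eqP va|/eqP vb].
    by exists (a, b); rewrite ?inE /= ?aX ?bX 1?eq_sym// /h /= va.
  by exists (b, a); rewrite ?inE /= ?aX ?bX ?ab// /h /= vb finset.setUC.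
rewrite inE /= => /and3P[vX uX uv] [-> ->].
rewrite finset.subUset !finset.sub1set vX uX cards2 (eq_sym v u) uv cards1 finset.set21 !andbT /=.
by apply/finset.set0Pn; exists v; rewrite finset.set21.
Qed.

Definition mixed_const : R :=
  k%:R * D%:R + site_const + k%:R ^+ 2 * D%:R ^+ 3.

Definition edge_clash e : nat := (\sum_(v in X e) \sum_(w in X e | w != v) clash v w)%N.

Definition edge_error e : R := 2 * eta * (tau * D%:R ^+ 2 * eps + tau ^+ 2 *
  (mixed_const + (edge_clash e)%:R * (k%:R * D%:R ^+ 2))).

(** Each ordered pair of distinct vertices lies in at most [D] edges, so the clashes are counted at
    most [D] times. *)
Lemma sum_edge_clash : (\sum_e edge_clash e <= D ^ 2 * k * #|Y|)%N.
Proof.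
apply: (@leq_trans (\sum_v \sum_w clash v w * D)); last first.
  under eq_bigr do rewrite -big_distrl.
  rewrite -big_distrl /=; apply: leq_trans (leq_mul sum_clash (leqnn D)) _.
  by rewrite -mulnA mulnC; apply: eq_leq; ring.
have E1 e : edge_clash e =
    (\sum_v \sum_w clash v w * [&& v \in X e, w \in X e & w != v])%N.
  rewrite /edge_clash big_mkcond; apply: eq_bigr => v _.
  case: (v \in X e) => /=; last by rewrite big1// => w _; rewrite muln0.
  rewrite big_mkcond; apply: eq_bigr => w _.
  by case: (_ && _); rewrite ?muln1 ?muln0.
under eq_bigr do rewrite E1.
rewrite exchange_big leq_sum //= => v _.
rewrite exchange_big leq_sum //= => w _.
rewrite -big_distrr leq_mul//=; case: (eqVneq v w) => [->|vw].
  by rewrite big1// => e _; rewrite /= !andbF.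
apply: leq_trans (codeg vw); rewrite -sum1_card [leqRHS]big_mkcond leq_sum// => e _.
by rewrite inE /= andbT; case: (_ && _).
Qed.

Lemma expansion_coef_le S (J : {set V}) : `|expansion_coef S J| <= 2 * tau ^+ #|J|.
Proof.
rewrite normrN normrM ler_pM//.
  rewrite (le_trans (ler_normD _ _))// normr1 normrX normrN1 expr1n.
  by lra.
rewrite normrM !normrX normrN (ger0_norm tau_ge0) ler_piMr ?exprn_ge0//.
by rewrite exprn_ile1// ger0_norm ?invr_ge0// invf_le1// ler1n.
Qed.

Let eps_ge0 : 0 <= eps. Proof. exact: le_trans eta_le. Qed.

Let site_const_ge0 : 0 <= site_const.
Proof. by rewrite addr_ge0// mulr_ge0 ?exprn_ge0. Qed.

Let mixed_const_ge0 : 0 <= mixed_const.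
Proof. by rewrite !addr_ge0 ?mulr_ge0 ?exprn_ge0. Qed.

Lemma edge_error_ge0 e : 0 <= edge_error e.
Proof.
by rewrite !(mulr_ge0, addr_ge0, exprn_ge0).
Qed.

Lemma normr_edge_mixed_le e J U (M : R) :
  (forall K, `|mixed K J U| <= M) -> `|edge_mixed e J U| <= M.
Proof.
move=> mM; apply: normr_mean_le => // K; rewrite normrM -[leRHS]mul1r ler_pM//.
by rewrite ger0_norm ?has_edge_ge0 ?has_edge_le1.
Qed.

(** Either a sign is left over and [mixed_le] applies, or [S = J] and [mixed_full_le] applies. *)
Lemma edge_mixed_sub_le e S (J : {set V}) : S \subset X e -> J \subset S -> (1 < #|J|)%N ->
  `|edge_mixed e J (S :\: J)| <=
  eta * (mixed_const + (edge_clash e)%:R * (k%:R * D%:R ^+ 2)).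
Proof.
move=> SX JS J1; have JX := fintype.subset_trans JS SX.
have Jk : (#|J| <= k)%N by exact: leq_trans (subset_leq_card JX) (sizeX e).
case: (eqVneq (S :\: J) finset.set0) => SJ; last first.
  apply: le_trans (normr_edge_mixed_le _ (fun K => mixed_le K Jk SJ)) _.
  rewrite mulrCA ler_wpM2l// /mixed_const -!addrA lerDl.
  by rewrite !addr_ge0 ?mulr_ge0 ?exprn_ge0.
have /card_gt0P[v vJ] : (0 < #|J|)%N by exact: ltnW.
rewrite SJ; apply: le_trans (mixed_full_le JX vJ) _; rewrite ler_wpM2l//.
rewrite natrD mulrDl natrM /mixed_const.
rewrite (_ : k%:R * D%:R * (k%:R * D%:R ^+ 2) = k%:R ^+ 2 * D%:R ^+ 3 :> R); last by ring.
rewrite addrA lerD//; first by rewrite lerD2r lerDr mulr_ge0.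
rewrite ler_wpM2r ?mulr_ge0 ?exprn_ge0// ler_nat /edge_clash.
by rewrite [leqRHS](bigD1 v) ?(fintype.subsetP JX)//= leq_addr.
Qed.

Lemma expansion_term_ge e S (J : {set V}) :
  S \subset X e -> S != finset.set0 -> J \subset S ->
  (if (#|S| == 2%N) && (#|J| == 1%N) then
     expansion_coef S J * edge_mixed e J (S :\: J) else 0) - edge_error e <=
  expansion_coef S J * edge_mixed e J (S :\: J).
Proof.
move=> SX S0 JS; case: ifP => [_|nopair]; first by rewrite gerBl edge_error_ge0.
suff : `|expansion_coef S J * edge_mixed e J (S :\: J)| <= edge_error e.
  by rewrite sub0r ler_norml => /andP[].
case: (boolP (odd #|S|)) => [oddS|evenS].
  rewrite /expansion_coef -signr_odd oddS expr1 subrr mul0r oppr0 mul0r normr0.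
  exact: edge_error_ge0.
have Jle := expansion_coef_le S J.
case: (ltngtP #|J| 1) => [J0|J1|J1].
(* With no sine chosen, the average of the signs over nonempty [S] is 0. *)
- have -> : J = finset.set0 by apply/eqP; rewrite -cards_eq0 -leqn0.
  rewrite finset.setD0 (_ : edge_mixed _ _ _ = 0) ?mulr0 ?normr0 ?edge_error_ge0//.
  by rewrite -[RHS](mean_cst mu_sum); apply: eq_mean => K; rewrite mixed_set0// mulr0.
- rewrite normrM /edge_error; apply: (@le_trans _ _ (2 * tau ^+ 2 *
    (eta * (mixed_const + (edge_clash e)%:R * (k%:R * D%:R ^+ 2))))).
    rewrite ler_pM ?edge_mixed_sub_le// (le_trans Jle)// ler_wpM2l//.
    by rewrite ler_wiXn2l// (le_trans tau_le)// invf_le1// ler1n.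
  rewrite -subr_ge0 (_ : _ - _ = 2 * eta * (tau * D%:R ^+ 2 * eps)); last by ring.
  by rewrite !mulr_ge0 ?exprn_ge0.
(* [S] is nonempty, of even size and not of size 2, so at least three signs remain beside the single
   sine. *)
- have SJ1 : (1 < #|S :\: J|)%N.
    rewrite cardsD (finset.setIidPr JS) J1.
    move: nopair evenS S0; rewrite J1 eqxx andbT -card_gt0.
    by case: #|S| => [|[|[|[|n]]]].
  move/eqP/cards1P: (J1) => [v Jv]; rewrite normrM.
  apply: (@le_trans _ _ (2 * tau * (eta * D%:R) ^+ 2)).
    rewrite ler_pM//; first by rewrite (le_trans Jle)// J1 expr1.
    by apply: normr_edge_mixed_le => K; rewrite Jv mixed_single_le// -Jv.
  rewrite /edge_error -subr_ge0 (_ : _ - _ = 2 * eta * (tau * D%:R ^+ 2 * (eps - eta) + tau ^+ 2 *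
    (mixed_const + (edge_clash e)%:R * (k%:R * D%:R ^+ 2)))); last by ring.
  have eta_eps : 0 <= eps - eta by rewrite subr_ge0.
  by rewrite !(eta_eps, mulr_ge0, addr_ge0, exprn_ge0).
Qed.

Lemma sum_edge_error : \sum_e edge_error e <=
  2 * eta * (tau * D%:R ^+ 2 * eps +
             tau ^+ 2 * (mixed_const + k%:R ^+ 2 * D%:R ^+ 4)) * #|E|%:R.
Proof.
rewrite /edge_error -mulr_sumr -[leRHS]mulrA ler_wpM2l ?mulr_ge0//.
have sum_cst (x : R) : \sum_(e : E) x = x * #|E|%:R by rewrite sumr_const mulr_natr.
have sum_affine (x y z t : R) (g : E -> nat) : \sum_e (x + y * (z + (g e)%:R * t)) =
    x * #|E|%:R + y * (z * #|E|%:R + (\sum_e g e)%:R * t).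
  by rewrite big_split /= sum_cst -mulr_sumr big_split /= sum_cst -mulr_suml natr_sum.
rewrite sum_affine [leRHS]mulrDl lerD2l -[leRHS]mulrA ler_wpM2l ?exprn_ge0//.
rewrite [leRHS]mulrDl lerD2l.
have YE : (\sum_e edge_clash e)%:R <= D%:R ^+ 2 * k%:R * #|E|%:R :> R.
  rewrite -natrX -!natrM ler_nat.
  by apply: leq_trans sum_edge_clash _; rewrite leq_mul// max_card.
rewrite (_ : k%:R ^+ 2 * D%:R ^+ 4 * _ = D%:R ^+ 2 * k%:R * #|E|%:R * (k%:R * D%:R ^+ 2));
  last by ring.
by rewrite ler_wpM2r ?mulr_ge0 ?exprn_ge0.
Qed.

Lemma card_subset_pairs e :
  \sum_(S : {set V} | (S \subset X e) && (S != finset.set0))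
    \sum_(J : {set V} | J \subset S) 1 <= 4 ^+ k :> R.
Proof.
have sub2 (S : {set V}) : S \subset X e -> \sum_(J : {set V} | J \subset S) 1 <= 2 ^+ k :> R.
  move=> SX; rewrite sumr_const -[leLHS]mulr_natl mulr1 -natrX ler_nat.
  rewrite (eq_card (_ : _ =i powerset S)) => [|J]; last by rewrite powersetE.
  by rewrite card_powerset leq_exp2l// (leq_trans (subset_leq_card SX)).
apply: (@le_trans _ _ (\sum_(S : {set V} | S \subset X e) 2 ^+ k)).
  rewrite big_mkcondr; apply: ler_sum => S SX; case: ifP => _; first exact: sub2.
  by rewrite exprn_ge0.
rewrite (_ : 4 ^+ k = 2 ^+ k * 2 ^+ k); last by rewrite -exprMn; congr (_ ^+ _); ring.
rewrite -[X in \sum_(S | _) X]mulr1 -mulr_sumr ler_wpM2l ?exprn_ge0//.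
exact: sub2.
Qed.

(** Each edge has at most [4 ^+ k] pairs [J], [S], each costing at most [edge_error e]. The terms
    with [S] of size 2 and [J] of size 1 are regrouped by ordered pairs of vertices, where
    [pair_gain] bounds them below. *)
Lemma mean_surp_ge :
  eta * (tau * (2^-1 ^+ k * vmin - 2 * D%:R ^+ 2 * eps) * #|Y|%:R -
    4 ^+ k * 2 * (tau * D%:R ^+ 2 * eps +
             tau ^+ 2 * (mixed_const + k%:R ^+ 2 * D%:R ^+ 4)) * #|E|%:R) <=
  mean mu (fun K => surp X R K).
Proof.
apply: le_trans (le_mean mu_ge0 surp_ge_mixed); rewrite mean_sum.
have half_ge0 m : 0 <= 2^-1 ^+ m :> R by rewrite exprn_ge0 ?invr_ge0.
have half_le1 m : 2^-1 ^+ m <= 1 :> R.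
  by rewrite exprn_ile1 ?invr_ge0// invf_le1// ler1n.
apply: (@le_trans _ _ (\sum_e (2^-1 ^+ #|X e| *
    (\sum_(v in X e) \sum_(u in X e | u != v) tau * edge_mixed e [set v] [set u]) -
    4 ^+ k * edge_error e))); last first.
  apply: ler_sum => e _; rewrite meanZl mean_sum.
  set W := 2^-1 ^+ #|X e|.
  have -> : \sum_(S : {set V} | (S \subset X e) && (S != finset.set0))
      mean mu (fun K => \sum_(J : {set V} | J \subset S)
        expansion_coef S J * (has_edge R e K * mixed K J (S :\: J))) =
    \sum_(S : {set V} | (S \subset X e) && (S != finset.set0))
      \sum_(J : {set V} | J \subset S) expansion_coef S J * edge_mixed e J (S :\: J).
    by apply: eq_bigr => S _; rewrite mean_sum; apply: eq_bigr => J _; rewrite meanZl.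
  apply: (@le_trans _ _ (W * (\sum_(v in X e) \sum_(u in X e | u != v)
      tau * edge_mixed e [set v] [set u] - 4 ^+ k * edge_error e))).
    rewrite mulrBr lerB//; apply: ler_piMl; last exact: half_le1.
    by apply: mulr_ge0; [exact: exprn_ge0 | exact: edge_error_ge0].
  apply: ler_wpM2l; first exact: half_ge0.
  (* The coefficient of such a pair is [- (2 * (- tau / 2))], which is [tau]. *)
  have pairE v u : u != v -> expansion_coef [set v; u] [set v] *
      edge_mixed e [set v] ([set v; u] :\: [set v]) = tau * edge_mixed e [set v] [set u].
    move=> uv; have SD : [set v; u] :\: [set v] = [set u].
      apply/setP => w; rewrite !inE; case: (eqVneq w v) => //= ->.
      by rewrite eq_sym (negbTE uv).
    rewrite SD /expansion_coef SD cards2 (eq_sym v u) uv !cards1 sqrrN expr1n !expr1.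
    by congr (_ * _); field.
  rewrite (_ : \sum_(v in X e) _ = \sum_(v in X e) \sum_(u in X e | u != v)
      expansion_coef [set v; u] [set v] *
      edge_mixed e [set v] ([set v; u] :\: [set v])); last first.
    by apply: eq_bigr => v _; apply: eq_bigr => u /andP[_ uv]; rewrite pairE.
  rewrite -(sum_edge_pairs e (fun S J => expansion_coef S J * edge_mixed e J (S :\: J))).
  apply: (@le_trans _ _ (\sum_(S : {set V} | (S \subset X e) && (S != finset.set0))
    \sum_(J : {set V} | J \subset S)
    ((if (#|S| == 2%N) && (#|J| == 1%N) then
     expansion_coef S J * edge_mixed e J (S :\: J) else 0) - edge_error e))); last first.
    apply: ler_sum => S /andP[SX S0]; apply: ler_sum => J JS.
    exact: expansion_term_ge.
  under [leRHS]eq_bigr do rewrite sumrB.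
  rewrite sumrB lerB// (le_trans _ (ler_wpM2r (edge_error_ge0 e) (card_subset_pairs e)))//.
  rewrite mulr_suml le_eqVlt; apply/orP; left; apply/eqP; apply: eq_bigr => S _.
  by rewrite mulr_suml; apply: eq_bigr => J _; rewrite mul1r.
rewrite sumrB mulrBr lerB//; last first.
  rewrite -mulr_sumr (le_trans (ler_wpM2l _ sum_edge_error)) ?exprn_ge0//.
  by rewrite le_eqVlt; apply/orP; left; apply/eqP; ring.
have -> : \sum_e 2^-1 ^+ #|X e| * (\sum_(v in X e) \sum_(u in X e | u != v)
      tau * edge_mixed e [set v] [set u]) =
    tau * \sum_v \sum_(u | u != v) \sum_(e | (v \in X e) && (u \in X e))
      2^-1 ^+ #|X e| * edge_mixed e [set v] [set u].
  under eq_bigr do rewrite mulr_sumr.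
  rewrite (exchange_big_dep predT)//= mulr_sumr; apply: eq_bigr => v _.
  under eq_bigr do rewrite mulr_sumr.
  rewrite (exchange_big_dep (fun u => u != v)) /=; last by move=> e u _ /andP[].
  rewrite mulr_sumr; apply: eq_bigr => u uv; rewrite mulr_sumr.
  by apply: eq_big => [e|e _]; rewrite ?uv ?andbT// mulrCA.
(* [Y] is split into its parallel classes; the diagonal classes are empty. *)
rewrite -mulrA mulrCA ler_wpM2l// -sum_sum_card_parallel natr_sum.
rewrite mulrA mulr_sumr ler_sum// => v _.
rewrite natr_sum mulr_sumr [leLHS](bigD1 v)//=.
rewrite (_ : parallel v v = finset.set0).
  rewrite cards0 mulr0 add0r; apply: ler_sum => u uv.
  by rewrite mulrAC; apply: pair_gain; rewrite eq_sym.
apply/setP => f; rewrite !inE; apply/negbTE/negP => /and3P[fY /eqP dv /eqP sv].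
by have := src_dst fY; rewrite dv sv eqxx.
Qed.

End LocalFields.

(** * Independence of blocks of random variables *)

Section IndependentBlocks.
Local Open Scope classical_set_scope.
Local Open Scope ereal_scope.
Context {d : measure_display} {T : measurableType d} {R : realType}.
Variables (P : probability T R) (I : choiceType) (dU : I -> measure_display).
Variables (U : forall i, measurableType (dU i)) (Z : forall i, {mfun T >-> U i}).
Hypothesis indepZ : mutually_independent P Z.
Implicit Types (J L : {fset I}) (A C : set T).

(** [B] is defined on all of [I] and trivial off [J], so that cylinders over different blocks can be
    intersected index by index. *)
Definition cylinder (J : {fset I}) : set (set T) := [set C |
  exists B : forall i, set (U i), [/\ forall i, measurable (B i),
    forall i, i \notin J -> B i = setT & C = \bigcap_i (Z i @^-1` B i)]].

Definition block_algebra (J : {fset I}) : set (set T) := <<s cylinder J >>.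

Lemma cylinder_subset J L : {subset J <= L} -> cylinder J `<=` cylinder L.
Proof.
move=> JL C [B [mB BT ->]]; exists B; split=> // i iL; apply: BT.
by apply: contra iL => /JL.
Qed.

Lemma cylinderE J B : (forall i, i \notin J -> B i = setT) ->
  \bigcap_i (Z i @^-1` B i) = \bigcap_(i in [set` J]) (Z i @^-1` B i).
Proof.
move=> BT; apply/seteqP; split=> [w Bw i _|w Bw i _]; first exact: Bw.
have [iJ|iJ] := boolP (i \in J); first exact: Bw.
by rewrite /preimage/= BT.
Qed.

Lemma cylinder_measurable J : cylinder J `<=` measurable.
Proof.
move=> _ [B [mB BT ->]]; rewrite (cylinderE BT).
apply: fin_bigcap_measurable => // i _.
by rewrite -[_ @^-1` _]setTI; exact: measurable_funPT.
Qed.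

Lemma block_algebra_measurable J : block_algebra J `<=` measurable.
Proof.
apply: smallest_sub; first exact: sigma_algebra_measurable.
exact: cylinder_measurable.
Qed.

Lemma cylinder_setT J : cylinder J setT.
Proof.
exists (fun=> setT); split=> //.
by apply/esym/seteqP; split=> // w _ i _.
Qed.

Lemma cylinder_setI J : setI_closed (cylinder J).
Proof.
move=> _ _ [B [mB BT ->]] [B' [mB' BT' ->]].
exists (fun i => B i `&` B' i); split=> [i|i iJ|].
- exact: measurableI.
- by rewrite BT// BT'// setIT.
- apply/seteqP; split=> [w [Bw B'w] i _|w Bw]; first by split; [exact: Bw|exact: B'w].
  by split=> i _; case: (Bw i).
Qed.

(** Over the union of the two blocks each index is constrained by at most one of the cylinders, so
    the product formulas match factor by factor. *)
Lemma cylinder_independent J L A C : [disjoint J & L]%fset ->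
  cylinder J A -> cylinder L C -> P (A `&` C) = P A * P C.
Proof.
move=> /fdisjointP dJL [B [mB BT ->]] [B' [mB' BT' ->]].
pose M := (J `|` L)%fset.
have BM i : i \notin M -> B i = setT.
  by rewrite in_fsetU negb_or => /andP[iJ _]; exact: BT.
have BM' i : i \notin M -> B' i = setT.
  by rewrite in_fsetU negb_or => /andP[_ iL]; exact: BT'.
have -> : \bigcap_i (Z i @^-1` B i) `&` \bigcap_i (Z i @^-1` B' i) =
    \bigcap_i (Z i @^-1` (B i `&` B' i)).
  apply/seteqP; split=> [w [Bw B'w] i _|w Bw]; first by split; [exact: Bw|exact: B'w].
  by split=> i _; case: (Bw i).
rewrite (cylinderE BM) (cylinderE BM') (@cylinderE M) => [|i iM]; last first.
  by rewrite BM// BM'// setIT.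
rewrite !indepZ// => [|i]; last exact: measurableI.
rewrite -big_split; apply: eq_bigr => i _ /=.
have [iJ|iJ] := boolP (i \in J).
  by rewrite BT' ?dJL// setIT preimage_setT probability_setT mule1.
by rewrite BT// setTI preimage_setT probability_setT mul1e.
Qed.

(** For fixed [C], the measures sending [A] to [P (A :&: C)] and to [P C * P A] agree on the
    pi-system [G], hence on the sigma-algebra it generates. *)
Let extend_independence (G H : set (set T)) :
  G `<=` measurable -> H `<=` measurable -> setI_closed G -> G setT ->
  (forall A C, G A -> H C -> P (A `&` C) = P A * P C) ->
  forall A C, <<s G >> A -> H C -> P (A `&` C) = P A * P C.
Proof.
move=> mG mH IG GT GH A C GA HC.
have mC : measurable C by exact: mH.
have Cr : (0 <= fine (P C))%R by rewrite fine_ge0.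
have := @g_sigma_algebra_measure_unique _ R T G mG (fun=> setT) (fun=> GT) _
  (mrestr P mC) (mscale (NngNum Cr) P) IG _ _ A GA.
rewrite /= /mrestr /mscale /= => ->; first by rewrite fineK ?fin_num_measure// muleC.
- by rewrite bigcup_const.
- move=> B GB; rewrite /mrestr /mscale /= fineK ?fin_num_measure// muleC.
  exact: GH.
- by move=> _; rewrite /mrestr setTI -ge0_fin_numE ?fin_num_measure.
Qed.

(** Independence is extended from cylinders to generated algebras in one argument at a time. *)
Lemma block_independent J L A C : [disjoint J & L]%fset ->
  block_algebra J A -> block_algebra L C -> P (A `&` C) = P A * P C.
Proof.
move=> dJL JA LC.
have H1 A' C' : <<s cylinder J >> A' -> cylinder L C' -> P (A' `&` C') = P A' * P C'.
  apply: extend_independence; [exact: cylinder_measurable|exact: cylinder_measurable|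
    exact: cylinder_setI|exact: cylinder_setT|].
  by move=> *; apply: cylinder_independent dJL _ _.
rewrite setIC muleC; move: LC JA.
apply: extend_independence; [exact: cylinder_measurable|exact: block_algebra_measurable|
    exact: cylinder_setI|exact: cylinder_setT|].
by move=> A' C' LA' JC'; rewrite setIC muleC; exact: H1.
Qed.

Lemma block_algebra_subset J L : {subset J <= L} -> block_algebra J `<=` block_algebra L.
Proof. by move=> /cylinder_subset; exact: sub_sigma_algebra2. Qed.

(** Taking preimages commutes with the set operations, so it suffices that the generating coordinate
    conditions pull back to cylinders. *)
Lemma is_function_of_block J A : is_function_of Z J A -> block_algebra J A.
Proof.
move=> [F]; rewrite /product_sigma_algebra => sF ->.
pose Phi (w : T) (i : J) : U (val i) := Z (val i) w.
suff : <<s [set C | exists (i : J) (B : set (U (val i))),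
    measurable B /\ C = [set z : forall i : J, U (val i) | B (z i)]] >> `<=`
    [set F | block_algebra J (Phi @^-1` F)] by move=> /(_ _ sF).
apply: smallest_sub => [|_ [i [B [mB ->]]] /=].
  split => [|C /= JC|G /= JG].
  - by rewrite /= preimage_set0; exact: sigma_algebra0.
  - by rewrite setTD preimage_setC -setTD; exact: sigma_algebraCD.
  - by rewrite preimage_bigcup; exact: sigma_algebra_bigcup.
apply: sub_sigma_algebra.
(* The family equal to [B] at [val i] and trivial elsewhere; [B] has to be transported along the
   equality of indices. *)
pose B' j : set (U j) := match pselect (val i = j) with
  | left e => eq_rect (val i) (fun j => set (U j)) B j e
  | right _ => setT end.
have B'i : B' (val i) = B.
  rewrite /B'; case: pselect => // e.
  by rewrite (Prop_irrelevance e erefl).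
exists B'; split=> [j|j jJ|].
- by rewrite /B'; case: pselect => // e; case: _ / e.
- rewrite /B'; case: pselect => // e.
  by case/negP: jJ; rewrite -e (valP i).
- apply/seteqP; split=> [w Bw j _|w Bw].
    rewrite /preimage /B'; by case: pselect => // e /=; case: _ / e.
  by have := Bw (val i) Logic.I; rewrite /preimage /= B'i.
Qed.

End IndependentBlocks.

(** * The law of the random edge set *)

Section EdgeSetLaw.
Local Open Scope classical_set_scope.
Context {d : measure_display} {T : measurableType d} {R : realType}.
Variables (P : probability T R) (I : choiceType) (dU : I -> measure_display).
Variables (U : forall i, measurableType (dU i)) (Z : forall i, {mfun T >-> U i}).
Variables (E : finType) (S : E -> {fset I}) (H : T -> {set E}).
Hypothesis indepZ : mutually_independent P Z.
Hypothesis eventS : forall e, is_function_of Z (S e) (edge_event H e).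
Implicit Types (A B K : {set E}).

Definition support A : {fset I} := (\bigcup_(e <- enum A) S e)%fset.

Lemma trace_block A K :
  block_algebra Z (support A) [set w | H w :&: A = K].
Proof.
have -> : [set w | H w :&: A = K] =
    \bigcap_e [set w | (e \in H w) && (e \in A) = (e \in K)].
  apply/seteqP; split=> [w <- e _|w HA]; first by rewrite /= !inE.
  by apply/setP => e; rewrite !inE; exact: HA.
apply: (@fin_bigcap_measurable _ (g_sigma_algebraType (cylinder Z (support A)))) => [|e _].
  exact: finite_finset.
have [eA|eA] := boolP (e \in A); last first.
  under eq_set do rewrite andbF.
  case: (e \in K).
    rewrite (_ : [set _ | _] = classical_sets.set0); first exact: measurable0.
    by apply/seteqP; split=> w.
  rewrite (_ : [set _ | _] = setT); first exact: measurableT.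
  by apply/seteqP; split=> w.
have ev : block_algebra Z (support A) (edge_event H e).
  apply: (@block_algebra_subset _ _ _ _ _ _ (S e)); last exact: is_function_of_block.
  by move=> i iS; apply/bigfcupP; exists e; rewrite // mem_enum eA.
under eq_set do rewrite andbT.
case: (e \in K).
  by rewrite (_ : [set _ | _] = edge_event H e)//; apply/seteqP.
rewrite (_ : [set _ | _] = ~` edge_event H e); last first.
  by apply/seteqP; split=> w /=; rewrite /edge_event /= => /negP; rewrite ?negbK // => /negbTE.
by rewrite -setTD; exact: sigma_algebraCD.
Qed.

Definition law K : R := fine (P [set w | H w = K]).

Lemma law_ge0 K : 0 <= law K. Proof. exact: fine_ge0. Qed.

Lemma measurable_edges_eq K : measurable [set w | H w = K].
Proof.
apply: (@block_algebra_measurable _ _ _ _ _ Z (support [set: E]%SET)).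
have -> : [set w | H w = K] = [set w | H w :&: [set: E]%SET = K].
  by apply/seteqP; split=> w /=; rewrite finset.setIT.
exact: trace_block.
Qed.

Lemma measurable_edges (Q : pred {set E}) : measurable [set w | Q (H w)].
Proof.
have -> : [set w | Q (H w)] = \bigcup_(K in [set K | Q K]) [set w | H w = K].
  by apply/seteqP; split=> [w QH|w [K /= QK ->]//]; exists (H w).
apply: fin_bigcup_measurable => [|K _]; first exact: finite_finset.
exact: measurable_edges_eq.
Qed.

(** [H] takes finitely many values, so its level sets partition [T] and the integral becomes a
    finite sum. *)
Lemma expectation_edges (f : {set E} -> R) :
  'E_P[fun w => f (H w)]%E = (mean law f)%:E.
Proof.
rewrite unlock.
have cover : \big[setU/set0]_(K <- enum {set E}) [set w | H w = K] = setT.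
  apply/seteqP; split=> // w _; rewrite -bigcup_seq; exists (H w) => //=.
  by rewrite mem_enum.
have := @integral_bigsetU_EFin _ T R P _ (fun K => [set w | H w = K])
  (fun w => f (H w)) (enum {set E}) measurable_edges_eq (enum_uniq _).
rewrite cover => ->.
- rewrite big_enum /mean -sumEFin /=; apply: eq_bigr => K _.
  rewrite (@eq_integral _ _ _ _ _ (cst (f K)%:E)) => [|w]; last first.
    by rewrite inE /= => ->.
  rewrite integral_cst; last exact: measurable_edges_eq.
  rewrite /law EFinM fineK 1?muleC// fin_num_measure//.
  exact: measurable_edges_eq.
- by move=> K L _ _ [w [/= <- <-]].
- move=> _ Y mY; rewrite setTI.
  have -> : (EFin \o (fun w => f (H w))) @^-1` Y = [set w | `[< Y (f (H w))%:E >]].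
    by apply/seteqP; split=> w /=; rewrite asboolE.
  exact: (measurable_edges (fun K => `[< Y (f K)%:E >])).
Qed.

Lemma probability_edges (Q : pred {set E}) :
  P [set w | Q (H w)] = (mean law (fun K => (Q K)%:R))%:E.
Proof.
rewrite -expectation_edges -(expectation_indic _ (measurable_edges Q)).
congr ('E_P[_]%E); apply/funext => w; rewrite indicE.
suff -> : (w \in [set w | Q (H w)]) = Q (H w) by [].
by apply/idP/idP; rewrite inE.
Qed.

Lemma sum_law : \sum_K law K = 1.
Proof.
have : mean law (fun K => true%:R) = 1.
  apply/EFin_inj; rewrite -(probability_edges (fun=> true)).
  by rewrite -(probability_setT P); congr (P _); apply/seteqP.
by move=> <-; apply: eq_bigr => K _; rewrite mulr1.
Qed.

Definition sharing e f : bool := ~~ [disjoint S e & S f]%fset.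

Let trace_indep A B K L : (forall e f, e \in A -> f \in B -> ~~ sharing e f) ->
  mean law (fun G => (G :&: A == K)%:R * (G :&: B == L)%:R) =
  mean law (fun G => (G :&: A == K)%:R) * mean law (fun G => (G :&: B == L)%:R).
Proof.
move=> AB; apply/EFin_inj; rewrite EFinM.
rewrite -(probability_edges (fun G => G :&: A == K)).
rewrite -(probability_edges (fun G => G :&: B == L)).
rewrite (@eq_mean _ _ law _ (fun G => ((G :&: A == K) && (G :&: B == L))%:R)); last first.
  by move=> G; rewrite -mulnb natrM.
rewrite -(probability_edges (fun G => (G :&: A == K) && (G :&: B == L))).
have setE C M : [set w | H w :&: C == M] = [set w | H w :&: C = M].
  by apply/seteqP; split=> w /= /eqP.
have -> : [set w | (H w :&: A == K) && (H w :&: B == L)] =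
    [set w | H w :&: A == K] `&` [set w | H w :&: B == L].
  by apply/seteqP; split=> w /= /andP.
rewrite !setE; apply: (block_independent indepZ _ (@trace_block A K) (@trace_block B L)).
apply/fdisjointP => i /bigfcupP[e]; rewrite mem_enum andbT => eA ie.
apply/negP => /bigfcupP[f]; rewrite mem_enum andbT => fB jf.
by have := AB e f eA fB; rewrite /sharing negbK => /fdisjointP/(_ i ie); rewrite jf.
Qed.

(** Functions of a trace are linear combinations of indicators of its values, for which independence
    is that of disjoint blocks. *)
Lemma edges_independent A B : (forall e f, e \in A -> f \in B -> ~~ sharing e f) ->
  forall phi psi : {set E} -> R,
  mean law (fun K => phi (K :&: A) * psi (K :&: B)) =
  mean law (fun K => phi (K :&: A)) * mean law (fun K => psi (K :&: B)).
Proof.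
move=> AB phi psi.
have dec (f : {set E} -> R) (C G : {set E}) :
    f (G :&: C) = \sum_K f K * (G :&: C == K)%:R.
  rewrite (bigD1 (G :&: C))//= eqxx mulr1 big1 ?addr0// => K.
  by rewrite eq_sym => /negbTE ->; rewrite mulr0.
have mdec (f : {set E} -> R) C : mean law (fun G => f (G :&: C)) =
    \sum_K f K * mean law (fun G => (G :&: C == K)%:R).
  rewrite (eq_mean _ (fun G => dec f C G)) mean_sum.
  by apply: eq_bigr => K _; rewrite meanZl.
rewrite !mdec.
rewrite (@eq_mean _ _ law _ (fun G => \sum_K \sum_L phi K * psi L *
    ((G :&: A == K)%:R * (G :&: B == L)%:R))); last first.
  move=> G; rewrite (dec phi A) (dec psi B) mulr_suml; apply: eq_bigr => K _.
  by rewrite mulr_sumr; apply: eq_bigr => L _; ring.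
rewrite mean_sum mulr_suml; apply: eq_bigr => K _.
rewrite mean_sum mulr_sumr; apply: eq_bigr => L _.
by rewrite meanZl trace_indep//; ring.
Qed.

End EdgeSetLaw.

(** * Counting shared variables and fixing the constants *)

Lemma card_sharing_le (I : choiceType) (V E : finType) (X : E -> {set V})
    (S : E -> {fset I}) (k D : nat) (u : V) (e : E) :
  (#|` S e| <= k)%N ->
  (forall i, (#|[pred f | (u \in X f) && (i \in S f)]| <= D)%N) ->
  (#|[set f | (u \in X f) && sharing S e f]| <= k * D)%N.
Proof.
move=> Sk codeg.
apply: (@leq_trans (\sum_(i <- S e) #|[set f | (u \in X f) && (i \in S f)]|)%N); last first.
  apply: (@leq_trans (\sum_(i <- S e) D)%N).
    by apply: leq_sum => i _; rewrite cardsE; exact: codeg.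
  by rewrite big_const_seq count_predT iter_addn_0 mulnC leq_mul.
apply: (@leq_trans #|\bigcup_(i <- S e) [set f | (u \in X f) && (i \in S f)]%SET|).
  apply: subset_leq_card; apply/fintype.subsetP => f.
  rewrite inE => /andP[uf /fdisjointP]; rewrite /sharing => nd.
  have [i iS jf] : exists2 i, i \in S e & i \in S f.
    apply: contrapT => no; apply: nd => i iS; apply/negP => jf; apply: no.
    by exists i.
  rewrite big_tnth; have /seq_tnthP[j ij] : i \in (S e : seq I) by [].
  by apply/bigcupP; exists j; rewrite // inE uf -ij jf.
elim/big_ind2: _ => [|s m s' m' sm sm'|//]; first by rewrite cards0.
by apply: leq_trans (leq_add sm sm'); rewrite cardsU leq_subr.
Qed.

Lemma exists_small (R : realFieldType) (A B x0 : R) : 0 <= A -> 0 < B -> 0 < x0 ->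
  exists x, [/\ 0 < x, x <= x0 & A * x <= B].
Proof.
move=> A0 B0 x00; have A1 : 0 < A + 1 by rewrite ltr_wpDl.
(* The denominator [A + 1] stays positive when [A = 0]. *)
exists (Num.min x0 (B / (A + 1))); split.
- by rewrite lt_min x00 divr_gt0.
- by rewrite ge_min lexx.
- apply: (@le_trans _ _ (A * (B / (A + 1)))).
    by rewrite ler_wpM2l// ge_min lexx orbT.
  by rewrite mulrA ler_pdivrMr// mulrC ler_wpM2l ?(ltW B0)// lerDl.
Qed.

Theorem theorem5p2 (R : realType) (k D : nat) (a b p q : R)
    (ha : 0 < a) (hb : 0 < b) (hp : 0 < p) (hq : 0 < q) :
  exists2 c : R, 0 < c &
    forall (m Delta : R) (V E : finType) (X : E -> {set V})
      (d : measure_display) (T : measurableType d) (P : probability T R)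
      (H : T -> {set E}),
      1 <= m -> 1 <= Delta ->
      linear_type P X H k D a b p q m Delta ->
      ((c * (m / Num.sqrt Delta))%:E <= 'E_P[fun w => surp X R (H w)])%E.
Proof.
(* [r] is the leading gain per edge of [Y] in [mean_surp_ge], with [p * q] as the lower bound for
   the variance. *)
pose r : R := 2^-1 ^+ k * (p * q).
pose d2 : R := D%:R ^+ 2.
pose C : R := mixed_const R k D + k%:R ^+ 2 * D%:R ^+ 4.
pose N : R := 4 ^+ k * 2.
have r0 : 0 < r by rewrite !mulr_gt0 ?exprn_gt0 ?invr_gt0.
have d20 : 0 <= d2 by rewrite exprn_ge0.
have N0 : 0 <= N by rewrite mulr_ge0 ?exprn_ge0.
have C0 : 0 <= C by rewrite !(addr_ge0, mulr_ge0, exprn_ge0).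
have rb0 : 0 < r * b / 8 by rewrite !mulr_gt0 ?invr_gt0.
have r20 : 0 < r / 2 by rewrite mulr_gt0 ?invr_gt0.
have [eps [eps0 eps1 epsle]] : exists x, [/\ 0 < x, x <= 1 &
    (2 * d2 + N * d2 * a) * x <= Num.min (r / 2) (r * b / 8)].
  by apply: exists_small; rewrite ?addr_ge0 ?mulr_ge0 ?(ltW ha)// lt_min r20.
have [tau [tau0 tau1 taule]] : exists x, [/\ 0 < x, x <= 2^-1 &
    (N * C * a) * x <= r * b / 8].
  by apply: exists_small; rewrite ?mulr_ge0 ?invr_gt0 ?(ltW ha).
move: epsle; rewrite le_min => /andP[eps_r eps_rb].
have {eps_r} eps_r : 2 * d2 * eps <= r / 2.
  by rewrite (le_trans _ eps_r)// ler_wpM2r ?(ltW eps0)// lerDl !mulr_ge0 ?(ltW ha).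
have {eps_rb} eps_rb : N * d2 * a * eps <= r * b / 8.
  by rewrite (le_trans _ eps_rb)// ler_wpM2r ?(ltW eps0)// lerDr mulr_ge0.
(* The gain is at least [r * b / 2], and the errors in [eps] and in [tau] take at most [r * b / 8]
   each, leaving [r * b / 4]. The factor [eps] comes from [eta]. *)
exists (eps * tau * (r * b / 4)).
  by rewrite !mulr_gt0 ?invr_gt0.
move=> m Delta V E X d T P H m1 Delta1 [I [dU [U [Z [S lt]]]]].
have [lt_size lt_cardE lt_ind lt_ssize lt_ev lt_cor [Y [Ym lt_Y]] lt_dg lt_cd lt_cds] := lt.
have m0 : 0 < m by exact: lt_le_trans m1.
(* A good edge exists because [b * m] is positive. It supplies a vertex [v0], the default for both
   ends of edges outside [Y]. *)
have /card_gt0P[e0 e0Y] : (0 < #|Y|)%N.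
  by rewrite -(ltr_nat R) (lt_le_trans _ Ym)// mulr_gt0.
have [[/card_gt1P[v0 _] _ _]] := lt_Y _ e0Y.
have /boolp.choice[so soP] (e : E) : exists s : V * V, e \in Y ->
    [/\ s.1 \in X e, s.2 \in X e & s.1 != s.2].
  case: (boolP (e \in Y)) => [eY|]; last by exists (v0, v0).
  by have [/card_gt1P[s [t [sX tX st]]] _ _] := lt_Y _ eY; exists (s, t).
have law0 := law_ge0 P H.
have law1 := sum_law P lt_ev.
have prob_edge e : P (edge_event H e) = (mean (law P H) (has_edge R e))%:E.
  exact: (probability_edges P lt_ev (fun K => e \in K)).
rewrite (expectation_edges P lt_ev) lee_fin.
have sqrt1 : 1 <= Num.sqrt Delta by rewrite -[leLHS]sqrtr1 ler_sqrt ?(le_trans ler01).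
have sqrt0 : 0 < Num.sqrt Delta by exact: lt_le_trans sqrt1.
(* This choice makes [eta ^+ 2 * Delta] equal to [eps ^+ 2], and it carries the factor
   [1 / sqrt Delta] of the conclusion. *)
pose eta := eps / Num.sqrt Delta.
have eta0 : 0 <= eta by rewrite divr_ge0 ?ltW.
have eta_eps : eta <= eps by rewrite ler_pdivrMr// ler_peMr// ltW.
have etaD : eta ^+ 2 * Delta <= eps.
  rewrite expr_div_n sqr_sqrtr ?(le_trans ler01)// divfK.
    by rewrite expr2 ler_piMr// ltW.
  by rewrite gt_eqF// (lt_le_trans ltr01).
have srcX e : e \in Y -> (so e).1 \in X e by move=> /soP[].
have dstX e : e \in Y -> (so e).2 \in X e by move=> /soP[].
have src_dst e : e \in Y -> (so e).1 != (so e).2 by move=> /soP[].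
have codeg u v : u != v -> (#|[set e | (u \in X e) && (v \in X e)]| <= D)%N.
  by move=> uv; rewrite cardsE; exact: lt_cd.
have codeg_share u e : (#|[set f | (u \in X f) && sharing S e f]| <= k * D)%N.
  by apply: card_sharing_le => // i; exact: lt_cds.
have deg u : #|[set e | u \in X e]|%:R <= Delta by rewrite cardsE; exact: lt_dg.
have share_sym : symmetric (sharing S).
  by move=> e f; rewrite /sharing fdisjoint_sym.
have correl e f : mean (law P H) (has_edge R e) * mean (law P H) (has_edge R f) <=
    mean (law P H) (fun K => has_edge R e K * has_edge R f K).
  rewrite -lee_fin EFinM -!prob_edge (le_trans (lt_cor e f))//.
  rewrite (@eq_mean _ _ _ _ (fun K => ((e \in K) && (f \in K))%:R)); last first.
    by move=> K; rewrite /has_edge -mulnb natrM.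
  rewrite -(probability_edges P lt_ev (fun K => (e \in K) && (f \in K))).
  rewrite le_eqVlt; apply/orP; left; apply/eqP; congr (P _).
  by apply/seteqP; split=> w /= /andP.
have var e : e \in Y ->
    p * q <= mean (law P H) (has_edge R e) * (1 - mean (law P H) (has_edge R e)).
  move=> eY; have [_ pe qe] := lt_Y _ eY; move: pe qe; rewrite prob_edge !lee_fin => pe qe.
  by rewrite ler_pM ?(ltW hp) ?(ltW hq)// lerBrDr addrC -lerBrDr.
apply: le_trans (mean_surp_ge law0 law1 (edges_independent lt_ind lt_ev)
  srcX dstX src_dst lt_size codeg codeg_share deg share_sym eta0 eta_eps etaD eps1
  correl var (ltW tau0) tau1).
rewrite -/r -/C -/d2 -/N.
rewrite (_ : eps * tau * (r * b / 4) * (m / Num.sqrt Delta) =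
  eta * (tau * (r * b / 4 * m))); last by rewrite /eta; ring.
rewrite ler_wpM2l// lerBrDr -[leRHS]mulrA.
have -> : N * (tau * d2 * eps + tau ^+ 2 * C) * #|E|%:R =
    tau * (N * (d2 * eps + tau * C) * #|E|%:R) by ring.
rewrite -mulrDr ler_wpM2l ?(ltW tau0)//.
apply: (@le_trans _ _ (r / 2 * (b * m))); last first.
  apply: ler_pM => //; [exact: ltW|by rewrite mulr_ge0 ?ltW|by move: eps_r; lra].
have errE : N * (d2 * eps + tau * C) * #|E|%:R <=
    (N * d2 * a * eps + N * C * a * tau) * m.
  rewrite (_ : _ * m = N * (d2 * eps + tau * C) * (a * m)); last by ring.
  by rewrite ler_wpM2l// !(mulr_ge0, addr_ge0) ?(ltW eps0) ?(ltW tau0).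
have : (N * d2 * a * eps + N * C * a * tau) * m <= r * b / 4 * m.
  by rewrite ler_wpM2r ?(ltW m0)//; lra.
by move: errE; lra.
Qed.
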